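(* Let $\gamma(s)=(x(s),y(s))$ be a parabolic soliton of the inverse curve shortening flow in $\mathbb{H}^2$, i.e. the first two components of the maximal solution $(x(s),y(s),\theta(s))$ of $$x'=\cos\theta,\qquad y'=\sin\theta,\qquad \theta'=\frac{1}{\sin\theta}-\frac{\cos\theta}{y}$$ with initial conditions $(x(0),y(0),\theta(0))=(0,y_0,\theta(0))$, where $y_0>0$, $\theta(0)\in(0,\pi)$ and $\theta(0)\neq\pi/2$. Then either $\gamma$ belongs to one of the two types, type I or type II, described in the context, or $\gamma$ is a concave graph $x=x(y)$ on the $y$-axis defined on some bounded interval $(0,x_2)$, where the intersection with the $x$-axis of the branch of $\gamma$ which meets the $x$-axis is orthogonal.
   Context: $\mathbb{H}^2$ is the upper half-plane $\{(x,y)\in\mathbb{R}^2: y>0\}$ with metric $(dx^2+dy^2)/y^2$. For a regular curve $\gamma=(x,y)$, the unit normal is $N=y\,(-y',x')/\sqrt{x'^2+y'^2}$ and the hyperbolic curvature is $\kappa=y\kappa_e+x'/\sqrt{x'^2+y'^2}$, where $\kappa_e=(x'y''-x''y')/(x'^2+y'^2)^{3/2}$. A parabolic soliton of the inverse curve shortening flow is a curve satisfying $1/\kappa=-\langle N,\partial_x\rangle$; when $\gamma$ is parametrized by Euclidean arc length with $x'=\cos\theta$, $y'=\sin\theta$, this is equivalent to the displayed system. Solutions are considered up to translation of the parameter and horizontal translation. A curve is a graph on the $y$-axis if it can be written as $x=x(y)$. The two types occur for the solutions of the system with $(x(0),y(0),\theta(0))=(0,\tilde y_0,\pi/2)$,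 $\tilde y_0>0$: Type I: $\gamma$ is a graph on the $y$-axis, approaches the line $y=0$ orthogonally (toward one end $y\to 0$ and the tangent direction becomes vertical), and there is a constant $Y>0$ such that the line $y=Y$ is a horizontal asymptote of $\gamma$. Type II: $\gamma$ is a graph $x=x(y)$ on a bounded interval $(m,M)$ of the $y$-axis, with $x(y)$ concave, $\lim_{y\to M}x'(y)=-\infty$ and $\lim_{y\to m}x'(y)=\infty$.
   Formalization: In type I, ''the line y=Y is a horizontal asymptote'' is taken to mean only that y tends to Y and the tangent becomes horizontal at that end; x stays bounded there, so with a genuine asymptote the claim fails (e.g. y_0=0.1, θ(0)=π/4). *)

(* Defs.v *)
From Stdlib Require Import Reals.
From Coquelicot Require Import Coquelicot.
Open Scope R_scope.

Definition in_itv (a b : Rbar) (s : R) : Prop := Rbar_lt a s /\ Rbar_lt s b.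

(* x, y, theta are total functions; only their values on (a, b) matter. *)
Record soliton_system (a b : Rbar) (x y theta : R -> R) : Prop := {
  sol_y_pos : forall s, in_itv a b s -> 0 < y s;
  sol_sin : forall s, in_itv a b s -> sin (theta s) <> 0;
  sol_x' : forall s, in_itv a b s -> is_derive x s (cos (theta s));
  sol_y' : forall s, in_itv a b s -> is_derive y s (sin (theta s));
  sol_theta' : forall s, in_itv a b s ->
    is_derive theta s (1 / sin (theta s) - cos (theta s) / y s) }.

Record maximal_solution (a b : Rbar) (x y theta : R -> R)
    (x0 y0 theta0 : R) : Prop := {
  max_zero : in_itv a b 0;
  max_sol : soliton_system a b x y theta;
  max_x0 : x 0 = x0;
  max_y0 : y 0 = y0;
  max_theta0 : theta 0 = theta0;
  max_maximal : forall (a' b' : Rbar) (x1 y1 theta1 : R -> R),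
    Rbar_le a' a -> Rbar_le b b' ->
    soliton_system a' b' x1 y1 theta1 ->
    (forall s, in_itv a b s ->
       x1 s = x s /\ y1 s = y s /\ theta1 s = theta s) ->
    a' = a /\ b' = b }.

(* Neighbourhood filter of the endpoint e inside (a, b), where e is a or b. *)
Definition toward (a b e : Rbar) : (R -> Prop) -> Prop :=
  within (in_itv a b) (Rbar_locally e).

Definition graph_on_y_axis (a b : Rbar) (x y : R -> R) : Prop :=
  exists f : R -> R, forall s, in_itv a b s -> x s = f (y s).

Definition graph_over (a b : Rbar) (x y : R -> R) (f : R -> R) (m M : R)
    : Prop :=
  (forall s, in_itv a b s -> m < y s < M /\ x s = f (y s)) /\
  (forall t, m < t < M -> exists s, in_itv a b s /\ y s = t).

Definition concave_on (f : R -> R) (m M : R) : Prop :=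
  forall u v t, m < u < M -> m < v < M -> 0 <= t <= 1 ->
    t * f u + (1 - t) * f v <= f (t * u + (1 - t) * v).

(* The unit tangent is (cos theta, sin theta): it becomes vertical when
   cos theta -> 0 and horizontal when sin theta -> 0. *)
Definition approaches_axis_orthogonally (a b e : Rbar) (y theta : R -> R)
    : Prop :=
  filterlim y (toward a b e) (locally 0) /\
  filterlim (fun s => cos (theta s)) (toward a b e) (locally 0).

(* The asymptote is the limit of the tangent lines at the end e.  It cannot be
   required that |x| -> +oo: where sin theta -> 0 with y -> Y > 0, one has
   - (cos theta)' = sin theta * theta' -> 1, so that end lies at finite arc
   length and x has a finite limit there. *)
Definition horizontal_asymptote (a b e : Rbar) (y theta : R -> R) (Y : R)
    : Prop :=
  filterlim y (toward a b e) (locally Y) /\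
  filterlim (fun s => sin (theta s)) (toward a b e) (locally 0).

(* After translating the parameter by s0 and x horizontally, the curve is a
   maximal solution issuing from (0, y0, pi/2). *)
Definition vertical_start_up_to_translation (a b : Rbar) (x y theta : R -> R)
    : Prop :=
  exists s0 y0 : R, in_itv a b s0 /\ 0 < y0 /\
    maximal_solution (Rbar_minus a s0) (Rbar_minus b s0)
      (fun s => x (s + s0) - x s0) (fun s => y (s + s0))
      (fun s => theta (s + s0)) 0 y0 (PI / 2).

Definition type_I (a b : Rbar) (x y theta : R -> R) : Prop :=
  vertical_start_up_to_translation a b x y theta /\
  graph_on_y_axis a b x y /\
  exists e e' : Rbar,
    ((e = a /\ e' = b) \/ (e = b /\ e' = a)) /\
    approaches_axis_orthogonally a b e y theta /\
    exists Y : R, 0 < Y /\ horizontal_asymptote a b e' y theta Y.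

(* m = 0 is allowed in the bounded interval (m, M). *)
Definition type_II (a b : Rbar) (x y theta : R -> R) : Prop :=
  vertical_start_up_to_translation a b x y theta /\
  exists (m M : R) (f : R -> R),
    graph_over a b x y f m M /\
    (forall t, m < t < M -> ex_derive f t) /\
    concave_on f m M /\
    filterlim (Derive f) (at_left M) (Rbar_locally m_infty) /\
    filterlim (Derive f) (at_right m) (Rbar_locally p_infty).

Definition concave_orthogonal_graph (a b : Rbar) (x y theta : R -> R) : Prop :=
  exists (x2 : R) (f : R -> R),
    graph_over a b x y f 0 x2 /\
    concave_on f 0 x2 /\
    exists (e : Rbar) (p : R),
      (e = a \/ e = b) /\
      filterlim x (toward a b e) (locally p) /\
      approaches_axis_orthogonally a b e y theta.

(* Main.v *)
Require Import Defs.
From Stdlib Require Import Reals Lra Lia Classical_Prop.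
From Coquelicot Require Import Coquelicot.
Open Scope R_scope.

(** Write u = cos theta and h = y - sin theta cos theta. Along a solution y
    increases and y sin(theta) theta' = h, u' = - h / y, (u / y)' = - 1 / y and
    (u / y + ln y)' = (sin theta - 1) / y <= 0.

    The last quantity bounds y at the right end, and then u / y bounds the
    arc length.  An end at finite arc length with y bounded and bounded away
    from 0 can only occur because sin theta -> 0, for otherwise the solution
    extends; as u' -> -1 there, u -> -1 at a right end and, by reversing the
    curve, u -> 1 at a left end.

    Let m be the limit of y at the left end.  Since h' = sin theta > 0 where
    h = 0, either h > 0 everywhere or h <= 0 on an initial part of the curve.
    In the first case x(y) is concave and u -> 1 at the left end, even if m = 0:
    this is type II.  In the second case theta decreases on the initial part, so
    u cannot tend to 1, hence m = 0, and u' = - 1 + u sin(theta) / y forces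
    u -> 0: this is type I.  In both cases u changes sign, which gives the
    vertical starting point; so the third alternative never has to be used. *)

(** * Ordinary differential equations with a Lipschitz field *)

(** Maximality only speaks of solutions on larger intervals, so it is exploited in one way: a
    solution is started at a limit point of the given one and glued on. Hence local existence comes
    first. Near horizontal directions theta' is unbounded. In u' the factor 1 / sin(theta) cancels,
    so u' stays bounded as long as y stays away from 0. Therefore u has a limit at a finite end of
    this kind before anything is known about theta, and theta is controlled only when that limit
    lies strictly between -1 and 1. Since y' = sin(theta), the equation for u is u' = -1 + u y' / y,
    linear in u with integrating factor 1 / y; this is the origin of u / y. Adding ln y, whose
    derivative is sin(theta) / y <= 1 / y, keeps the sign of the derivative while producing a term
    that dominates for large y. The two ends are not symmetric: y increases, so it is bounded below
    toward the right end, whereas it may tend to 0 toward the left end. There reversing the curve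
    gives no information, and the singular term u sin(theta) / y has to be treated directly. *)

Lemma norm_minus_sym {V : NormedModule R_AbsRing} (u v : V) :
  norm (minus u v) = norm (minus v u).
Proof. rewrite <- (opp_minus v u). apply norm_opp. Qed.

Lemma norm_minus_diag {V : NormedModule R_AbsRing} (u : V) :
  norm (minus u u) = 0.
Proof. rewrite minus_eq_zero. apply norm_zero. Qed.

Lemma norm_minus_triangle {V : NormedModule R_AbsRing} (u v w : V) :
  norm (minus u w) <= norm (minus u v) + norm (minus v w).
Proof. rewrite (minus_trans v u w). apply norm_triangle. Qed.

Lemma lipschitz_continuous {U V : NormedModule R_AbsRing} (f : U -> V) (L : R)
  (f_lip : forall u v, norm (minus (f u) (f v)) <= L * norm (minus u v))
  (u : U) : continuous f u.
Proof.
  apply filterlim_locally_ball_norm. intros eps.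
  (* [Rabs L + 1] replaces [L] so that the divisor is positive whatever the sign of [L]. *)
  assert (HL : 0 < Rabs L + 1) by (pose proof (Rabs_pos L); lra).
  assert (Hd : 0 < eps / (Rabs L + 1))
    by (apply Rdiv_lt_0_compat; [apply cond_pos | lra]).
  generalize (locally_ball_norm u (mkposreal _ Hd)). apply filter_imp.
  intros v Hv. unfold ball_norm in *. simpl in Hv.
  eapply Rle_lt_trans; [apply f_lip|].
  apply Rle_lt_trans with ((Rabs L + 1) * norm (minus v u)).
  - apply Rmult_le_compat_r; [apply norm_ge_0|]. pose proof (Rle_abs L). lra.
  - apply Rlt_le_trans with ((Rabs L + 1) * (eps / (Rabs L + 1))).
    + apply Rmult_lt_compat_l; lra.
    + right. field. lra.
Qed.

Lemma minus_plus_cancel_l {G : AbelianGroup} (v p q : G) :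
  minus (plus v p) (plus v q) = minus p q.
Proof.
  unfold minus. rewrite opp_plus, (plus_comm v p), <- plus_assoc.
  now rewrite (plus_assoc v (opp v)), plus_opp_r, plus_zero_l.
Qed.

Lemma plus_minus_l {G : AbelianGroup} (p q : G) : minus (plus p q) p = q.
Proof.
  unfold minus. rewrite (plus_comm p q), <- (plus_assoc q p), plus_opp_r. apply plus_zero_r.
Qed.

(** * Picard iteration for a bounded, globally Lipschitz field *)

Section Picard.

Context {V : CompleteNormedModule R_AbsRing}.
Variables (F : V -> V) (L K : R).
Hypothesis F_lip : forall u v, norm (minus (F u) (F v)) <= L * norm (minus u v).
Hypothesis F_bnd : forall u, norm (F u) <= K.
Hypothesis L_pos : 0 < L.
Variable v0 : V.

(** Because [F] is bounded and Lipschitz on the whole space, no iterate can leave a domain: all of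
    them exist for all times, and only their convergence requires short times. *)
Fixpoint picard_iter (n : nat) (t : R) : V :=
  match n with
  | O => v0
  | S n => plus v0 (RInt (fun s => F (picard_iter n s)) 0 t)
  end.

(** The [K]-Lipschitz bound in time is shared by all iterates and by their limit, so this single
    integrability statement serves both. *)
Lemma ex_RInt_lipschitz (phi : R -> V)
  (phi_lip : forall s t, norm (minus (phi s) (phi t)) <= K * Rabs (s - t))
  (s t : R) : ex_RInt (fun r => F (phi r)) s t.
Proof.
  apply ex_RInt_continuous. intros r _.
  apply (continuous_comp phi F).
  - exact (lipschitz_continuous (U := R_NormedModule) phi K phi_lip r).
  - exact (lipschitz_continuous F L F_lip _).
Qed.

Lemma picard_integral_lipschitz (phi : R -> V)
  (phi_int : forall s t, ex_RInt (fun r => F (phi r)) s t) (s t : R) :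
  norm (minus (plus v0 (RInt (fun r => F (phi r)) 0 s))
              (plus v0 (RInt (fun r => F (phi r)) 0 t))) <= K * Rabs (s - t).
Proof.
  replace (minus _ _) with (RInt (fun r => F (phi r)) t s).
  - rewrite Rmult_comm. apply (norm_RInt_le_const_abs (fun r => F (phi r))).
    + intros; apply F_bnd.
    + apply (RInt_correct (V := V)), phi_int.
  - rewrite <- (RInt_Chasles (V := V) _ 0 t s) by apply phi_int.
    rewrite (minus_plus_cancel_l (G := V) v0). symmetry. apply (plus_minus_l (G := V)).
Qed.

Lemma K_nonneg : 0 <= K.
Proof. exact (Rle_trans _ _ _ (norm_ge_0 _) (F_bnd v0)). Qed.

Lemma picard_iter_lipschitz (n : nat) (s t : R) :
  norm (minus (picard_iter n s) (picard_iter n t)) <= K * Rabs (s - t).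
Proof.
  revert s t. induction n as [|n IH]; intros s t; simpl.
  - rewrite (norm_minus_diag (V := V)).
    apply Rmult_le_pos; [apply K_nonneg | apply Rabs_pos].
  - apply picard_integral_lipschitz. intros. now apply ex_RInt_lipschitz.
Qed.

(** Chosen so that [L * picard_radius = / 2]: on this time interval each integration halves the
    distance between consecutive iterates. *)
Definition picard_radius : R := / (2 * L).

Lemma picard_radius_pos : 0 < picard_radius.
Proof. apply Rinv_0_lt_compat. lra. Qed.

Lemma picard_iter_step (n : nat) (t : R) (Ht : Rabs t <= picard_radius) :
  norm (minus (picard_iter (S n) t) (picard_iter n t))
    <= K * picard_radius * (/ 2) ^ n.
Proof.
  pose proof K_nonneg as HK. pose proof picard_radius_pos as Hr.
  revert t Ht. induction n as [|n IH]; intros t Ht.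
  (* Writing [v0] as the value of the first iterate at time 0 reduces the base case to the Lipschitz
     bound of that iterate. *)
  - replace (picard_iter 0 t) with (picard_iter 1 0).
    + eapply Rle_trans; [apply (picard_iter_lipschitz 1)|].
      rewrite Rminus_0_r. simpl. rewrite Rmult_1_r.
      now apply Rmult_le_compat_l.
    + simpl. rewrite RInt_point. apply plus_zero_r.
  - simpl (picard_iter (S (S n)) t).
    change (picard_iter (S n) t)
      with (plus v0 (RInt (fun s => F (picard_iter n s)) 0 t)) at 1.
    rewrite (minus_plus_cancel_l (G := V) v0).
    pose proof (fun k => ex_RInt_lipschitz _ (picard_iter_lipschitz k) 0 t) as Hex.
    assert (Hin : forall r, Rmin 0 t <= r <= Rmax 0 t -> Rabs r <= picard_radius).
    { intros r Hr'. unfold Rmin, Rmax in Hr'. destruct (Rle_dec 0 t);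
      revert Ht; unfold Rabs; repeat destruct Rcase_abs; lra. }
    apply Rle_trans with
      (Rabs (t - 0) * (L * (K * picard_radius * (/ 2) ^ n))).
    + refine (norm_RInt_le_const_abs
        (fun r => minus (F (picard_iter (S n) r)) (F (picard_iter n r))) 0 t _ _ _ _).
      * intros r Hr'. eapply Rle_trans; [apply F_lip|].
        apply Rmult_le_compat_l; [lra|]. now apply IH, Hin.
      * apply (is_RInt_minus (V := V)); apply (RInt_correct (V := V)).
        -- exact (Hex (S n)).
        -- exact (Hex n).
    + rewrite Rminus_0_r.
      assert (0 <= L * (K * picard_radius * (/ 2) ^ n)).
      { apply Rmult_le_pos; [lra|]. apply Rmult_le_pos.
        - apply Rmult_le_pos; lra.
        - apply pow_le. lra. }
      eapply Rle_trans; [apply Rmult_le_compat_r; eassumption|].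
      right. simpl. unfold picard_radius. field. lra.
Qed.

(** The factor [1 - (/ 2) ^ k] comes from the exact partial geometric sum; the cruder bound without
    it would not pass through the induction on [k]. *)
Lemma picard_iter_cauchy (n k : nat) (t : R) (Ht : Rabs t <= picard_radius) :
  norm (minus (picard_iter (n + k) t) (picard_iter n t))
    <= 2 * (K * picard_radius * (/ 2) ^ n) * (1 - (/ 2) ^ k).
Proof.
  induction k as [|k IH].
  - rewrite Nat.add_0_r, (norm_minus_diag (V := V)). simpl. lra.
  - rewrite Nat.add_succ_r.
    eapply Rle_trans; [apply (norm_minus_triangle _ (picard_iter (n + k) t))|].
    eapply Rle_trans;
      [apply Rplus_le_compat; [exact (picard_iter_step (n + k) t Ht) | exact IH]|].
    rewrite pow_add. simpl pow. lra.
Qed.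

(** Freezing time outside [[- d, d]] turns estimates valid for short times into uniform ones on all
    of [R], so that convergence can take place in the complete space of functions [R -> V]. *)
Definition clamp (d t : R) : R := Rmax (- d) (Rmin d t).

Lemma clamp_id (d t : R) : Rabs t <= d -> clamp d t = t.
Proof.
  intros H%Rabs_le_between. unfold clamp.
  rewrite Rmin_right, Rmax_right; lra.
Qed.

Lemma clamp_bound (d t : R) : 0 < d -> Rabs (clamp d t) <= d.
Proof.
  intros Hd. apply Rabs_le_between. unfold clamp, Rmax, Rmin.
  repeat destruct Rle_dec; lra.
Qed.

Lemma clamp_lipschitz (d s t : R) : 0 < d ->
  Rabs (clamp d s - clamp d t) <= Rabs (s - t).
Proof.
  intros Hd. unfold clamp, Rmax, Rmin.
  repeat destruct Rle_dec; unfold Rabs; repeat destruct Rcase_abs; lra.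
Qed.

Lemma picard_uniform_limit : exists phi : R -> V,
  forall eps : posreal, eventually (fun n => forall t,
    norm (minus (picard_iter n (clamp picard_radius t)) (phi t)) < eps).
Proof.
  pose proof K_nonneg as HK. pose proof picard_radius_pos as Hr.
  set (psi := fun n t => picard_iter n (clamp picard_radius t)).
  assert (HC : forall eps : posreal, exists N, forall n m, (N <= n)%nat ->
    (N <= m)%nat -> forall t, norm (minus (psi n t) (psi m t)) < eps).
  { intros eps.
    assert (Hq : Rabs (/ 2) < 1) by (rewrite Rabs_pos_eq; lra).
    (* The Cauchy estimate is at most [2 * K * picard_radius * (/ 2) ^ N], which has to fall below
       [eps / 2]; the summand 1 keeps the divisor positive when [K = 0]. *)
    assert (He : 0 < eps / (4 * K * picard_radius + 1)).
    { apply Rdiv_lt_0_compat; [apply cond_pos|]. nra. }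
    destruct (pow_lt_1_zero _ Hq _ He) as [N HN].
    exists N.
    assert (HB : forall n, (N <= n)%nat -> forall t,
      norm (minus (psi n t) (psi N t)) < eps / 2).
    { intros n Hn t. replace n with (N + (n - N))%nat by lia.
      eapply Rle_lt_trans.
      - apply picard_iter_cauchy, clamp_bound, Hr.
      - specialize (HN N (Nat.le_refl _)).
        assert (Hp : 0 < (/ 2) ^ N) by (apply pow_lt; lra).
        assert (Hp' : 0 < (/ 2) ^ (n - N)) by (apply pow_lt; lra).
        rewrite Rabs_pos_eq in HN by lra.
        assert (HKr : 0 <= K * picard_radius) by (apply Rmult_le_pos; lra).
        apply Rlt_div_r in HN; [|lra].
        assert (0 <= K * picard_radius * (/2) ^ N * (/ 2) ^ (n - N)).
        { repeat apply Rmult_le_pos; lra. }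
        lra. }
    intros n m Hn Hm t.
    eapply Rle_lt_trans; [apply (norm_minus_triangle _ (psi N t))|].
    rewrite (norm_minus_sym (V := V) (psi N t)).
    eapply Rlt_le_trans;
      [apply Rplus_lt_compat; [exact (HB n Hn t) | exact (HB m Hm t)] | lra]. }
  destruct (proj1 (filterlim_locally_cauchy (U := @fct_CompleteSpace R V)
    (F := eventually) psi)) as [phi Hphi].
  - intros eps. destruct (HC eps) as [N HN]. exists (fun n => (N <= n)%nat).
    split; [now exists N|]. intros n m Hn Hm t.
    apply (norm_compat1 (V := V)). now apply HN.
  - exists phi. intros eps.
    (* [norm_factor] is the price of passing from balls of the uniform structure to balls of the
       norm. *)
    assert (He : 0 < eps / (@norm_factor _ V))
      by (apply Rdiv_lt_0_compat; [apply cond_pos | apply norm_factor_gt_0]).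
    apply filterlim_locally with (eps := mkposreal _ He) in Hphi.
    revert Hphi. apply filter_imp. intros n Hn t.
    specialize (Hn t). apply (norm_compat2 (V := V)) in Hn. simpl in Hn.
    replace ((@norm_factor _ V) * (eps / @norm_factor _ V)) with (pos eps) in Hn; [exact Hn|].
    field. apply Rgt_not_eq, norm_factor_gt_0.
Qed.

Theorem picard_lipschitz : exists (d : R) (phi : R -> V), 0 < d /\
  phi 0 = v0 /\ forall t, Rabs t < d -> is_derive phi t (F (phi t)).
Proof.
  pose proof picard_radius_pos as Hr.
  destruct picard_uniform_limit as [phi Hphi].
  set (psi := fun n t => picard_iter n (clamp picard_radius t)) in *.
  (* The convergence is uniform and survives composition with [F]; this permits exchanging limit and
     integral below. *)
  assert (Hcv : filterlim (fun n s => F (psi n s)) eventually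
    (locally ((fun s => F (phi s)) : fct_UniformSpace R V))).
  { apply (filterlim_locally (U := fct_UniformSpace R V)). intros eps.
    assert (He : 0 < eps / L) by (apply Rdiv_lt_0_compat; [apply cond_pos|lra]).
    generalize (Hphi (mkposreal _ He)). apply filter_imp. intros n Hn t.
    apply (norm_compat1 (V := V)). eapply Rle_lt_trans; [apply F_lip|].
    apply Rlt_le_trans with (L * (eps / L)).
    - apply Rmult_lt_compat_l; [lra|]. apply Hn.
    - right. field. lra. }
  assert (Hpt : forall t, filterlim (fun n => psi n t) eventually (locally (phi t))).
  { intros t. apply (filterlim_locally_ball_norm (U := V)). intros eps.
    generalize (Hphi eps). apply filter_imp. intros n Hn. apply Hn. }
  assert (psi_lip : forall n s t, norm (minus (psi n s) (psi n t)) <= K * Rabs (s - t)).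
  { intros n s t. eapply Rle_trans; [apply picard_iter_lipschitz|].
    apply Rmult_le_compat_l; [apply K_nonneg|]. now apply clamp_lipschitz. }
  assert (phi_lip : forall s t, norm (minus (phi s) (phi t)) <= K * Rabs (s - t)).
  { intros s t.
    apply (filterlim_le (F := eventually)
      (fun n => norm (minus (psi n s) (psi n t))) (fun _ => K * Rabs (s - t))
      (norm (minus (phi s) (phi t))) (K * Rabs (s - t))).
    - now exists O.
    - eapply filterlim_comp; [|apply (filterlim_norm (V := V))].
      refine (filterlim_comp_2 (fun n => psi n s) (fun n => opp (psi n t)) plus
        (Hpt s) _ (filterlim_plus (V := V) _ _)).
      exact (filterlim_comp _ _ _ _ opp _ _ _ (Hpt t) (filterlim_opp (V := V) _)).
    - apply filterlim_const. }
  (* Both sides are limits of the same sequence [psi (S n) t]: the left one by convergence of the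
     iterates, the right one by the recursion and the convergence of the integrals. *)
  assert (Hint : forall t, Rabs t <= picard_radius ->
    phi t = plus v0 (RInt (fun s => F (phi s)) 0 t)).
  { intros t Ht.
    assert (Hin : forall r, Rmin 0 t <= r <= Rmax 0 t -> Rabs r <= picard_radius).
    { intros r Hr'. unfold Rmin, Rmax in Hr'. destruct (Rle_dec 0 t);
      revert Ht; unfold Rabs; repeat destruct Rcase_abs; lra. }
    destruct (filterlim_RInt (fun n s => F (psi n s)) 0 t eventually _
      (fun s => F (phi s)) (fun n => RInt (fun s => F (psi n s)) 0 t)) as [If [HIf1 HIf2]].
    - intros n. apply (RInt_correct (V := V)). now apply ex_RInt_lipschitz.
    - exact Hcv.
    - rewrite (is_RInt_unique (V := V) _ _ _ _ HIf2).
      apply (filterlim_locally_unique (F := eventually) (fun n => psi (S n) t)).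
      + apply (filterlim_comp _ _ _ S (fun n => psi n t) eventually eventually).
        * apply eventually_subseq. intros n. lia.
        * apply Hpt.
      + apply (filterlim_ext
          (fun n => plus v0 (RInt (fun s => F (psi n s)) 0 t))).
        * intros n. unfold psi at 2. simpl. rewrite (clamp_id _ t) by assumption.
          f_equal. apply RInt_ext. intros r Hr'. unfold psi.
          rewrite clamp_id; [easy|]. apply Hin. lra.
        * exact (filterlim_comp_2 (fun _ => v0) _ plus (filterlim_const v0) HIf1
            (filterlim_plus (V := V) _ _)). }
  exists picard_radius, phi. split; [exact Hr|]. split.
  - rewrite Hint by (rewrite Rabs_R0; lra). rewrite RInt_point. apply plus_zero_r.
  - intros t Ht.
    apply (is_derive_ext_loc (fun t => plus v0 (RInt (fun s => F (phi s)) 0 t))).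
    + assert (Hd : 0 < picard_radius - Rabs t) by lra.
      exists (mkposreal _ Hd). intros r Hr'. symmetry. apply Hint.
      change (Rabs (r - t) < picard_radius - Rabs t) in Hr'.
      pose proof (Rabs_triang_inv r t). lra.
    + rewrite <- (plus_zero_l (F (phi t))).
      apply (is_derive_plus (fun _ => v0)); [exact (is_derive_const (V := V) v0 t)|].
      apply (is_derive_RInt (fun s => F (phi s)) _ 0).
      * apply filter_forall. intros r. apply (RInt_correct (V := V)).
        now apply ex_RInt_lipschitz.
      * apply (continuous_comp phi F).
        -- exact (lipschitz_continuous (U := R_NormedModule) phi K phi_lip t).
        -- exact (lipschitz_continuous F L F_lip _).
Qed.

End Picard.

(** * Local existence of solitons *)

(** Boundedness is carried along because it is what makes products of Lipschitz functions Lipschitz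
    again. *)
Definition bounded_lipschitz (f : R * R -> R) : Prop :=
  exists K, (forall u, Rabs (f u) <= K) /\
    (forall u v, Rabs (f u - f v) <= K * norm (minus u v)).

Lemma bounded_lipschitz_weaken (f : R * R -> R) (K1 K2 : R)
  (f_bnd : forall u, Rabs (f u) <= K1)
  (f_lip : forall u v, Rabs (f u - f v) <= K2 * norm (minus u v)) :
  bounded_lipschitz f.
Proof.
  exists (Rmax K1 K2). split.
  - intros u. eapply Rle_trans; [apply f_bnd | apply Rmax_l].
  - intros u v. eapply Rle_trans; [apply f_lip|].
    apply Rmult_le_compat_r; [apply norm_ge_0 | apply Rmax_r].
Qed.

(** Boundedness is asked of the outer function alone, so that the unbounded coordinates [fst] and
    [snd] may be inserted. *)
Lemma bounded_lipschitz_comp (f : R * R -> R) (g : R -> R) (C K1 K2 : R)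
  (f_lip : forall u v, Rabs (f u - f v) <= C * norm (minus u v))
  (g_bnd : forall t, Rabs (g t) <= K1)
  (g_lip : forall s t, Rabs (g s - g t) <= K2 * Rabs (s - t)) :
  bounded_lipschitz (fun u => g (f u)).
Proof.
  assert (HK2 : 0 <= K2).
  { pose proof (g_lip 1 0) as H. rewrite Rminus_0_r, Rabs_R1 in H.
    pose proof (Rabs_pos (g 1 - g 0)). lra. }
  apply (bounded_lipschitz_weaken _ K1 (K2 * C)); [intros; apply g_bnd|].
  intros u v. eapply Rle_trans; [apply g_lip|]. rewrite Rmult_assoc.
  now apply Rmult_le_compat_l.
Qed.

Lemma bounded_lipschitz_minus (f g : R * R -> R) :
  bounded_lipschitz f -> bounded_lipschitz g ->
  bounded_lipschitz (fun u => f u - g u).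
Proof.
  intros [K1 [B1 L1]] [K2 [B2 L2]]. exists (K1 + K2). split.
  - intros u. specialize (B1 u). specialize (B2 u).
    unfold Rabs in *; repeat destruct Rcase_abs; lra.
  - intros u v. specialize (L1 u v). specialize (L2 u v).
    rewrite Rmult_plus_distr_r.
    unfold Rabs in *; repeat destruct Rcase_abs; lra.
Qed.

Lemma bounded_lipschitz_mult (f g : R * R -> R) :
  bounded_lipschitz f -> bounded_lipschitz g ->
  bounded_lipschitz (fun u => f u * g u).
Proof.
  intros [K1 [B1 L1]] [K2 [B2 L2]].
  apply (bounded_lipschitz_weaken _ (K1 * K2) (K1 * K2 + K1 * K2)).
  - intros u. rewrite Rabs_mult. apply Rmult_le_compat; auto using Rabs_pos.
  - intros u v.
    replace (f u * g u - f v * g v)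
      with ((f u - f v) * g u + f v * (g u - g v)) by ring.
    eapply Rle_trans; [apply Rabs_triang|]. rewrite !Rabs_mult.
    set (N := norm (minus u v)).
    assert (HN : 0 <= N) by apply norm_ge_0.
    replace ((K1 * K2 + K1 * K2) * N) with (K1 * N * K2 + K1 * (K2 * N)) by ring.
    apply Rplus_le_compat; apply Rmult_le_compat; auto using Rabs_pos.
Qed.

Lemma fst_lipschitz (u v : R * R) : Rabs (fst u - fst v) <= 1 * norm (minus u v).
Proof. rewrite Rmult_1_l. apply (norm_le_prod_norm_1 (minus u v)). Qed.

Lemma snd_lipschitz (u v : R * R) : Rabs (snd u - snd v) <= 1 * norm (minus u v).
Proof. rewrite Rmult_1_l. apply (norm_le_prod_norm_2 (minus u v)). Qed.

Lemma norm_pair_le (p : R * R) : norm p <= Rabs (fst p) + Rabs (snd p).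
Proof.
  change (sqrt (Rabs (fst p) ^ 2 + Rabs (snd p) ^ 2) <= Rabs (fst p) + Rabs (snd p)).
  pose proof (Rabs_pos (fst p)). pose proof (Rabs_pos (snd p)).
  
  rewrite <- (sqrt_pow2 (Rabs (fst p) + Rabs (snd p))) by lra.
  apply sqrt_le_1_alt. nra.
Qed.

Lemma lipschitz_of_derive_bound (f f' : R -> R) (K : R)
  (f_der : forall t, is_derive f t (f' t)) (f'_bnd : forall t, Rabs (f' t) <= K)
  (s t : R) : Rabs (f s - f t) <= K * Rabs (s - t).
Proof.
  destruct (MVT_gen f t s f') as [c [_ ->]].
  - intros; apply f_der.
  - intros r _. apply continuity_pt_filterlim.
    apply (ex_derive_continuous f). now exists (f' r).
  - rewrite Rabs_mult. apply Rmult_le_compat_r; [apply Rabs_pos | apply f'_bnd].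
Qed.

Lemma sin_lipschitz (s t : R) : Rabs (sin s - sin t) <= 1 * Rabs (s - t).
Proof.
  apply (lipschitz_of_derive_bound sin cos); [apply is_derive_sin|].
  intros r. apply Rabs_le, COS_bound.
Qed.

Lemma cos_lipschitz (s t : R) : Rabs (cos s - cos t) <= 1 * Rabs (s - t).
Proof.
  apply (lipschitz_of_derive_bound cos (fun r => - sin r)); [apply is_derive_cos|].
  intros r. rewrite Rabs_Ropp. apply Rabs_le, SIN_bound.
Qed.

(** A substitute for [/ t] that is bounded and Lipschitz on the whole line and exact where
    [c <= t]. *)
Definition inv_above (c t : R) : R := / Rmax c t.

Lemma inv_above_bound (c t : R) : 0 < c -> Rabs (inv_above c t) <= / c.
Proof.
  intros Hc. unfold inv_above. pose proof (Rmax_l c t).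
  rewrite Rabs_pos_eq; [|left; apply Rinv_0_lt_compat; lra].
  apply Rinv_le_contravar; lra.
Qed.

Lemma inv_above_lipschitz (c s t : R) : 0 < c ->
  Rabs (inv_above c s - inv_above c t) <= (/ c * / c) * Rabs (s - t).
Proof.
  intros Hc. pose proof (Rmax_l c s). pose proof (Rmax_l c t).
  replace (inv_above c s - inv_above c t)
    with (inv_above c s * inv_above c t * (Rmax c t - Rmax c s))
    by (unfold inv_above; field; lra).
  rewrite !Rabs_mult.
  apply Rmult_le_compat; try apply Rmult_le_pos; try apply Rabs_pos.
  - apply Rmult_le_compat; try apply Rabs_pos; now apply inv_above_bound.
  - unfold Rmax; repeat destruct Rle_dec; unfold Rabs; repeat destruct Rcase_abs; lra.
Qed.

Lemma inv_above_eq (c t : R) : c <= t -> inv_above c t = / t.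
Proof. intros H. unfold inv_above. now rewrite Rmax_right. Qed.

(* The system for (y, theta), with 1 / sin theta = sin theta / sin^2 theta and
   1 / y cut off where sin^2 theta or y is below c. *)
Definition cutoff_field (c : R) (u : R * R) : R * R :=
  (sin (snd u),
   sin (snd u) * inv_above c (sin (snd u) * sin (snd u))
     - cos (snd u) * inv_above c (fst u)).

(** The plane is given the norm of the complex numbers regarded as a complete real normed space,
    which is the setting of the Picard theorem. *)
Lemma cutoff_field_bounded_lipschitz (c : R) : 0 < c -> exists K, 0 < K /\
  (forall u, norm (cutoff_field c u : C_R_CompleteNormedModule) <= K) /\
  (forall u v, norm (minus (cutoff_field c u : C_R_CompleteNormedModule)
     (cutoff_field c v)) <= K * norm (minus (u : C_R_CompleteNormedModule) v)).
Proof.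
  intros Hc.
  assert (Hsin : bounded_lipschitz (fun u => sin (snd u))).
  { apply (bounded_lipschitz_comp snd sin 1 1 1); auto using snd_lipschitz, sin_lipschitz.
    intros; apply Rabs_le, SIN_bound. }
  assert (Hcos : bounded_lipschitz (fun u => cos (snd u))).
  { apply (bounded_lipschitz_comp snd cos 1 1 1); auto using snd_lipschitz, cos_lipschitz.
    intros; apply Rabs_le, COS_bound. }
  assert (H2 : bounded_lipschitz (fun u => snd (cutoff_field c u))).
  { apply bounded_lipschitz_minus; apply bounded_lipschitz_mult; auto.
    - destruct (bounded_lipschitz_mult _ _ Hsin Hsin) as [K [_ HK]].
      apply (bounded_lipschitz_comp _ (inv_above c) K (/ c) (/ c * / c) HK);
        intros; auto using inv_above_bound, inv_above_lipschitz.
    - apply (bounded_lipschitz_comp _ (inv_above c) 1 (/ c) (/ c * / c) fst_lipschitz);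
        intros; auto using inv_above_bound, inv_above_lipschitz. }
  destruct Hsin as [K1 [B1 L1]]. destruct H2 as [K2 [B2 L2]].
  exists (K1 + K2 + 1).
  assert (0 <= K1) by exact (Rle_trans _ _ _ (Rabs_pos _) (B1 (0, 0))).
  assert (0 <= K2) by exact (Rle_trans _ _ _ (Rabs_pos _) (B2 (0, 0))).
  split; [lra|]. split.
  - intros u. eapply Rle_trans; [apply (norm_pair_le (cutoff_field c u))|].
    specialize (B1 u). specialize (B2 u). simpl in *. lra.
  - intros u v.
    eapply Rle_trans; [apply (norm_pair_le (minus (cutoff_field c u) (cutoff_field c v)))|].
    apply Rle_trans with (K1 * norm (minus u v) + K2 * norm (minus u v)).
    + apply Rplus_le_compat; [apply L1 | apply L2].
    + rewrite <- Rmult_plus_distr_r. apply Rmult_le_compat_r; [apply norm_ge_0|lra].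
Qed.

Lemma is_derive_fst (f : R -> R * R) (t : R) (l : R * R) :
  is_derive (V := prod_NormedModule _ R_NormedModule R_NormedModule) f t l ->
  is_derive (fun s => fst (f s)) t (fst l).
Proof.
  intros H. unfold is_derive in *.
  refine (filterdiff_ext_lin _ _ _ (filterdiff_comp' f fst t _ fst H _) _).
  - apply filterdiff_linear, is_linear_fst.
  - reflexivity.
Qed.

Lemma is_derive_snd (f : R -> R * R) (t : R) (l : R * R) :
  is_derive (V := prod_NormedModule _ R_NormedModule R_NormedModule) f t l ->
  is_derive (fun s => snd (f s)) t (snd l).
Proof.
  intros H. unfold is_derive in *.
  refine (filterdiff_ext_lin _ _ _ (filterdiff_comp' f snd t _ snd H _) _).
  - apply filterdiff_linear, is_linear_snd.
  - reflexivity.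
Qed.

Lemma is_derive_continuous (f : R -> R) (t l : R) :
  is_derive f t l -> continuous f t.
Proof. intros H. apply (ex_derive_continuous f). now exists l. Qed.

(** The field does not involve x, so the iteration runs on (y, theta) and x is then found by
    integration. The cutoff is inactive at [e], hence near [e] by continuity, and there the solution
    of the cut-off system solves the true one. *)
Lemma soliton_local_existence (e xe ye te : R) :
  0 < ye -> sin te <> 0 -> exists (d : R) (x y theta : R -> R),
    0 < d /\ x e = xe /\ y e = ye /\ theta e = te /\
    soliton_system (e - d) (e + d) x y theta.
Proof.
  intros Hy Hs.
  assert (Hss : 0 < sin te * sin te) by nra.
  (* Halving the minimum makes both inequalities at [e] strict, so they persist in a
     neighbourhood. *)
  set (c := Rmin ye (sin te * sin te) / 2).
  assert (Hc : 0 < c /\ c < ye /\ c < sin te * sin te).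
  { unfold c, Rmin. destruct Rle_dec; lra. }
  destruct Hc as [Hc [Hcy Hcs]].
  destruct (cutoff_field_bounded_lipschitz c Hc) as [K [HK [HB HL]]].
  destruct (@picard_lipschitz C_R_CompleteNormedModule (cutoff_field c) K K HL HB HK (ye, te))
    as [d [phi [Hd [Hphi0 Hphi]]]].
  set (y := fun s => fst (phi (s - e))). set (th := fun s => snd (phi (s - e))).
  assert (Dy : forall s, Rabs (s - e) < d -> is_derive y s (sin (th s))).
  { intros s Hr. rewrite <- (Rmult_1_l (sin (th s))).
    apply (is_derive_comp (fun r => fst (phi r)) (fun s => s - e)).
    - exact (is_derive_fst phi _ _ (Hphi _ Hr)).
    - auto_derive; [easy | ring]. }
  assert (Dth : forall s, Rabs (s - e) < d ->
    is_derive th s (snd (cutoff_field c (y s, th s)))).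
  { intros s Hr. rewrite <- (Rmult_1_l (snd _)).
    apply (is_derive_comp (fun r => snd (phi r)) (fun s => s - e)).
    - exact (is_derive_snd phi _ _ (Hphi _ Hr)).
    - auto_derive; [easy | ring]. }
  assert (E0 : Rabs (e - e) < d) by (rewrite Rminus_eq_0, Rabs_R0; lra).
  assert (ye0 : y e = ye) by (unfold y; now rewrite Rminus_eq_0, Hphi0).
  assert (te0 : th e = te) by (unfold th; now rewrite Rminus_eq_0, Hphi0).
  assert (Ly : locally e (fun s => c < y s)).
  { apply (is_derive_continuous _ _ _ (Dy e E0)), open_gt. now rewrite ye0. }
  assert (Ls : locally e (fun s => c < sin (th s) * sin (th s))).
  { assert (Cs : continuous (fun s => sin (th s) * sin (th s)) e).
    { apply (continuous_mult (fun s => sin (th s)) (fun s => sin (th s)));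
      apply continuous_comp; try exact (is_derive_continuous _ _ _ (Dth e E0));
      apply continuous_sin. }
    apply Cs, open_gt. now rewrite te0. }
  destruct (filter_and _ _ Ly Ls) as [[d2 Hd2] Hloc]. simpl in Hloc.
  set (d' := Rmin d d2 / 2).
  assert (Hd' : 0 < d' /\ d' < d /\ d' < d2).
  { unfold d', Rmin. destruct Rle_dec; lra. }
  assert (Hi : forall s, in_itv (e - d') (e + d') s -> Rabs (s - e) < d').
  { intros s [H1 H2]. simpl in H1, H2. apply Rabs_lt_between. lra. }
  assert (Hx : forall s, in_itv (e - d') (e + d') s ->
     is_derive (fun s => xe + RInt (fun r => cos (th r)) e s) s (cos (th s))).
  { intros s Hin. rewrite <- (Rplus_0_l (cos (th s))).
    apply (is_derive_plus (fun _ => xe)); [exact (is_derive_const (V := R_NormedModule) xe s)|].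
    assert (Cc : forall r, Rabs (r - e) < d -> continuous (fun r => cos (th r)) r).
    { intros r Hr. apply continuous_comp; [|apply continuous_cos].
      exact (is_derive_continuous _ _ _ (Dth r Hr)). }
    pose proof (Hi s Hin) as Hsd.
    apply (is_derive_RInt (fun r => cos (th r)) _ e).
    - assert (Hg : 0 < d - Rabs (s - e)) by lra.
      exists (mkposreal _ Hg). intros r Hr. simpl in Hr.
      change (Rabs (r - s) < d - Rabs (s - e)) in Hr.
      apply (RInt_correct (V := R_CompleteNormedModule)).
      apply (ex_RInt_continuous (V := R_CompleteNormedModule)).
      intros q Hq. apply Cc. revert Hq Hr. unfold Rmin, Rmax.
      destruct Rle_dec; unfold Rabs; repeat destruct Rcase_abs; lra.
    - apply Cc. lra. }
  exists d', (fun s => xe + RInt (fun r => cos (th r)) e s), y, th.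
  split; [easy|]. split; [rewrite RInt_point; apply Rplus_0_r|].
  split; [easy|]. split; [easy|]. constructor.
  - intros s Hin. specialize (Hi s Hin).
    assert (Hb : Rabs (s - e) < d2) by lra. specialize (Hloc s Hb). lra.
  - intros s Hin E. specialize (Hi s Hin).
    assert (Hb : Rabs (s - e) < d2) by lra. specialize (Hloc s Hb).
    rewrite E in Hloc. lra.
  - exact Hx.
  - intros s Hin. specialize (Hi s Hin). apply Dy. lra.
  - intros s Hin. specialize (Hi s Hin).
    assert (Hb : Rabs (s - e) < d2) by lra. specialize (Hloc s Hb).
    assert (Hsd : Rabs (s - e) < d) by lra.
    generalize (Dth s Hsd).
    replace (snd (cutoff_field c (y s, th s)))
      with (1 / sin (th s) - cos (th s) / y s); [easy|].
    simpl. rewrite !inv_above_eq by lra.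
    assert (sin (th s) <> 0) by (intros E; rewrite E in Hloc; lra).
    field. split; lra.
Qed.

(** * Ends of an interval and extension of solutions *)

Lemma in_itv_between (a b : Rbar) (s r t : R) :
  in_itv a b s -> in_itv a b t -> s <= r <= t -> in_itv a b r.
Proof.
  intros [H1 _] [_ H2] [H3 H4]. split.
  - exact (Rbar_lt_le_trans a s r H1 H3).
  - exact (Rbar_le_lt_trans r t b H4 H2).
Qed.

Lemma in_itv_locally (a b : Rbar) (s : R) : in_itv a b s -> locally s (in_itv a b).
Proof.
  intros [H1 H2]. apply filter_and.
  - exact (open_Rbar_gt a s H1).
  - exact (open_Rbar_lt b s H2).
Qed.

Lemma in_itv_greater (a b : Rbar) (s : R) : in_itv a b s ->
  exists t, in_itv a b t /\ s < t.
Proof.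
  intros [[d Hd] H]%in_itv_locally. exists (s + d / 2). split; [|lra].
  apply H. change (Rabs (s + d / 2 - s) < d).
  rewrite Rabs_pos_eq; lra.
Qed.

Lemma in_itv_opp (a b : Rbar) (s : R) :
  in_itv (Rbar_opp b) (Rbar_opp a) s <-> in_itv a b (- s).
Proof.
  unfold in_itv. destruct a, b; simpl; split; intros [H1 H2]; split; try easy; lra.
Qed.

Lemma in_itv_less (a b : Rbar) (s : R) : in_itv a b s ->
  exists t, in_itv a b t /\ t < s.
Proof.
  intros H. destruct (in_itv_greater (Rbar_opp b) (Rbar_opp a) (- s)) as [t [Ht Hst]].
  - apply in_itv_opp. now rewrite Ropp_involutive.
  - exists (- t). split; [now apply in_itv_opp | lra].
Qed.

(** Removes the distinction between finite and infinite ends from all later arguments. The point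
    [s0] rules out an empty interval and supplies a starting point when the filter neighbourhood
    reaches beyond [a]. *)
Lemma toward_right_iff (a b : Rbar) (s0 : R) (P : R -> Prop) : in_itv a b s0 ->
  (toward a b b P <->
   exists s1, in_itv a b s1 /\ forall s, in_itv a b s -> s1 < s -> P s).
Proof.
  intros H0. unfold toward, within. destruct b as [b| |].
  - split.
    + intros [d Hd]. exists (Rmax s0 (b - d / 2)).
      pose proof (cond_pos d).
      assert (H1 : in_itv a b (Rmax s0 (b - d / 2))).
      { split; [|apply Rmax_lub_lt; [apply H0 | simpl; lra]].
        apply Rbar_lt_le_trans with s0; [apply H0|apply Rmax_l]. }
      split; [exact H1|]. intros s Hs Hs1. apply Hd; [|exact Hs].
      destruct Hs as [_ Hs]. simpl in Hs. pose proof (Rmax_r s0 (b - d / 2)).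
      change (Rabs (s - b) < d).
      rewrite Rabs_left; lra.
    + intros [s1 [[_ H1] HP]]. simpl in H1.
      assert (Hd : 0 < b - s1) by lra. exists (mkposreal _ Hd).
      intros s Hb Hs. apply HP; [exact Hs|].
      change (Rabs (s - b) < b - s1) in Hb. apply Rabs_lt_between in Hb. lra.
  - split.
    + intros [M HM]. exists (Rmax s0 M). split.
      * split; [|easy]. apply Rbar_lt_le_trans with s0; [apply H0|apply Rmax_l].
      * intros s Hs Hs1. apply HM; [|exact Hs].
        pose proof (Rmax_r s0 M). lra.
    + intros [s1 [_ HP]]. exists s1. intros s Hs1 Hs. now apply HP.
  - now destruct H0.
Qed.

(** Reflection in the parameter exchanges the ends, so facts about the left end can be drawn from
    those about the right end. *)
Lemma toward_opp (a b e : Rbar) (P : R -> Prop) :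
  toward a b e P <->
  toward (Rbar_opp b) (Rbar_opp a) (Rbar_opp e) (fun s => P (- s)).
Proof.
  assert (H : forall a b e (P : R -> Prop), toward a b e P ->
    toward (Rbar_opp b) (Rbar_opp a) (Rbar_opp e) (fun s => P (- s))).
  { clear. intros a b e P H. unfold toward, within in *.
    assert (Ho : filterlim Ropp (Rbar_locally (Rbar_opp e)) (Rbar_locally e)).
    { rewrite <- (Rbar_opp_involutive e) at 2. apply filterlim_Rbar_opp. }
    generalize (Ho _ H). unfold filtermap. apply filter_imp.
    intros s Hs Hin. now apply Hs, in_itv_opp. }
  split; [apply H|]. intros H1%H. rewrite !Rbar_opp_involutive in H1.
  revert H1. unfold toward, within. apply filter_imp.
  intros s Hs Hin. rewrite <- (Ropp_involutive s). auto.
Qed.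

Lemma toward_left_iff (a b : Rbar) (s0 : R) (P : R -> Prop) : in_itv a b s0 ->
  (toward a b a P <->
   exists s1, in_itv a b s1 /\ forall s, in_itv a b s -> s < s1 -> P s).
Proof.
  intros H0. rewrite toward_opp.
  rewrite (toward_right_iff _ _ (- s0))
    by (apply in_itv_opp; now rewrite Ropp_involutive).
  split; intros [s1 [H1 HP]]; exists (- s1).
  - split; [now apply in_itv_opp|]. intros s Hs Hlt.
    rewrite <- (Ropp_involutive s). apply HP; [|lra].
    apply in_itv_opp. now rewrite Ropp_involutive.
  - split; [apply in_itv_opp; now rewrite Ropp_involutive|].
    intros s Hs Hlt. apply HP; [now apply in_itv_opp | lra].
Qed.

Lemma filterlim_toward_left_reverse {T : Type} (a b : Rbar) (f : R -> T)
  (G : (T -> Prop) -> Prop) :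
  filterlim (fun s => f (- s)) (toward (Rbar_opp b) (Rbar_opp a) (Rbar_opp a)) G ->
  filterlim f (toward a b a) G.
Proof.
  intros H P HP. apply toward_opp. exact (H P HP).
Qed.

Global Instance toward_filter (a b e : Rbar) : Filter (toward a b e).
Proof. apply within_filter, Rbar_locally_filter. Qed.

Lemma toward_right_proper (a b : Rbar) (s0 : R) : in_itv a b s0 ->
  ProperFilter (toward a b b).
Proof.
  intros H0. split; [|apply toward_filter]. intros P HP.
  apply (toward_right_iff a b s0) in HP; [|exact H0].
  destruct HP as [s1 [H1 HP]]. destruct (in_itv_greater _ _ _ H1) as [t [Ht Hlt]].
  exists t. now apply HP.
Qed.

Lemma toward_right_after (a b : Rbar) (s0 : R) : in_itv a b s0 ->
  toward a b b (fun s => in_itv a b s /\ s0 < s).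
Proof.
  intros H0. apply (toward_right_iff a b s0); [exact H0|]. now exists s0.
Qed.

Lemma filterlim_lt {T : Type} (F : (T -> Prop) -> Prop) (f : T -> R) (l c : R) :
  filterlim f F (locally l) -> l < c -> F (fun s => f s < c).
Proof. intros Hf Hlc. exact (Hf _ (open_lt c l Hlc)). Qed.

Lemma filterlim_gt {T : Type} (F : (T -> Prop) -> Prop) (f : T -> R) (l c : R) :
  filterlim f F (locally l) -> c < l -> F (fun s => c < f s).
Proof. intros Hf Hlc. exact (Hf _ (open_gt c l Hlc)). Qed.

(** * Limits at an end from monotonicity or derivative bounds *)

Lemma mvt_closed (f f' : R -> R) (s t : R) : s <= t ->
  (forall r, s <= r <= t -> is_derive f r (f' r)) ->
  exists c, s <= c <= t /\ f t - f s = f' c * (t - s).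
Proof.
  intros Hst Hf. destruct (MVT_gen f s t f') as [c [Hc E]].
  - rewrite Rmin_left, Rmax_right by lra. intros r Hr. apply Hf. lra.
  - rewrite Rmin_left, Rmax_right by lra. intros r Hr.
    apply continuity_pt_filterlim, (is_derive_continuous _ _ (f' r)), Hf, Hr.
  - rewrite Rmin_left, Rmax_right in Hc by lra. now exists c.
Qed.

Lemma nondecreasing_of_derive (f f' : R -> R) (s t : R) : s <= t ->
  (forall r, s <= r <= t -> is_derive f r (f' r)) ->
  (forall r, s <= r <= t -> 0 <= f' r) -> f s <= f t.
Proof.
  intros Hst Hf Hp. destruct (mvt_closed f f' s t Hst Hf) as [c [Hc E]].
  specialize (Hp c Hc). nra.
Qed.

Lemma monotone_limit_right (a b : Rbar) (f : R -> R) (s0 K : R)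
  (Hs0 : in_itv a b s0)
  (f_mono : forall s t, in_itv a b t -> s0 <= s <= t -> f s <= f t)
  (f_bnd : forall s, in_itv a b s -> s0 <= s -> f s <= K) :
  exists l, filterlim f (toward a b b) (locally l) /\
    forall s, in_itv a b s -> s0 <= s -> f s <= l.
Proof.
  destruct (completeness (fun v => exists s, in_itv a b s /\ s0 <= s /\ v = f s))
    as [l [Hub Hlub]].
  - exists K. intros v [s [Hs [H0 ->]]]. now apply f_bnd.
  - exists (f s0), s0. split; [easy|]. split; [lra | easy].
  - assert (Hle : forall s, in_itv a b s -> s0 <= s -> f s <= l).
    { intros s Hs H0. apply Hub. now exists s. }
    exists l. split; [|exact Hle].
    apply filterlim_locally. intros eps.
    destruct (classic
      (exists s, in_itv a b s /\ s0 <= s /\ l - eps < f s)) as [[s1 [H1 [H01 Hs1]]]|N].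
    + apply (toward_right_iff a b s0); [exact Hs0|]. exists s1. split; [exact H1|].
      intros s Hs Hlt. change (Rabs (f s - l) < eps).
      assert (f s1 <= f s) by (apply f_mono; [exact Hs | lra]).
      assert (f s <= l) by (apply Hle; [exact Hs | lra]).
      apply Rabs_lt_between. pose proof (cond_pos eps). lra.
    + exfalso. pose proof (cond_pos eps).
      assert (l <= l - eps); [|lra].
      apply Hlub. intros v [s [Hs [H0 ->]]].
      apply Rnot_lt_le. intros C. apply N. now exists s.
Qed.

(** Adding [K * s] makes the function nondecreasing, so it has a limit once it is bounded, and the
    linear term has a limit because [b] is finite. *)
Lemma derive_bound_limit_right (a : Rbar) (b : R) (f f' : R -> R) (s0 K : R)
  (Hs0 : in_itv a b s0)
  (f_der : forall s, in_itv a b s -> is_derive f s (f' s))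
  (f'_bnd : forall s, in_itv a b s -> s0 <= s -> Rabs (f' s) <= K) :
  exists l, filterlim f (toward a b b) (locally l).
Proof.
  assert (HK : forall s, in_itv a b s -> s0 <= s -> - K <= f' s <= K).
  { intros s H H0. now apply Rabs_le_between, f'_bnd. }
  assert (Hsub : forall s r t, in_itv a b t -> s0 <= s -> s <= r <= t -> in_itv a b r).
  { intros s r t Ht Hs Hr. apply (in_itv_between a b s0 r t); [exact Hs0|exact Ht|lra]. }
  (* In the bound, [f] and [K * s] each gain at most [K * (b - s0)]. *)
  destruct (monotone_limit_right a b (fun s => f s + K * s) s0
    (f s0 + K * s0 + 2 * K * (b - s0)) Hs0) as [l [Hl _]].
  - intros s t Ht Hs.
    apply (nondecreasing_of_derive (fun s => f s + K * s) (fun s => f' s + K)); [lra| |].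
    + intros r Hr. pose proof (f_der r (Hsub s r t Ht ltac:(lra) Hr)) as D.
      apply (is_derive_plus f (fun s => K * s)); [exact D|].
      auto_derive; [easy | ring].
    + intros r Hr. pose proof (HK r (Hsub s r t Ht ltac:(lra) Hr)). lra.
  - intros s Hs H0.
    destruct (mvt_closed f f' s0 s H0) as [c [Hc E]].
    + intros r Hr. apply f_der, (Hsub s0 r s); [exact Hs|lra|exact Hr].
    + pose proof (HK c (Hsub s0 c s Hs ltac:(lra) Hc) ltac:(lra)) as B.
      destruct Hs as [_ Hs]. simpl in Hs.
      assert (f' c * (s - s0) <= K * (s - s0)) by (apply Rmult_le_compat_r; lra).
      assert (K * s <= K * b) by (apply Rmult_le_compat_l; lra).
      assert (K * (s - s0) <= K * (b - s0)) by (apply Rmult_le_compat_l; lra).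
      lra.
  - exists (l + - (K * b)).
    apply (filterlim_ext (fun s => (f s + K * s) + - (K * s))); [intros; ring|].
    refine (filterlim_comp_2 _ _ Rplus Hl _ (filterlim_plus (V := R_NormedModule) _ _)).
    apply (filterlim_filter_le_1 (F := locally b)); [apply filter_le_within|].
    apply (is_derive_continuous (fun s => - (K * s)) b (- K)).
    auto_derive; [easy | ring].
Qed.

(** * Gluing solutions at an end point *)

Lemma is_derive_of_punctured (g dg : R -> R) (e d : R) : 0 < d ->
  continuous g e -> continuous dg e ->
  (forall s, 0 < Rabs (s - e) < d -> is_derive g s (dg s)) ->
  is_derive g e (dg e).
Proof.
  intros Hd Cg Cdg Hder. apply is_derive_Reals. intros eps Heps.
  destruct (proj1 (filterlim_locally dg (dg e)) Cdg (mkposreal eps Heps)) as [[d1 Hd1] H1].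
  simpl in H1.
  assert (Hm : 0 < Rmin d d1) by now apply Rmin_pos.
  exists (mkposreal _ Hm). simpl. intros h Hh0 Hh.
  pose proof (Rmin_l d d1). pose proof (Rmin_r d d1).
  assert (Hin : forall r, Rmin e (e + h) <= r <= Rmax e (e + h) ->
    Rabs (r - e) <= Rabs h).
  { intros r. unfold Rmin, Rmax. destruct Rle_dec; unfold Rabs;
    repeat destruct Rcase_abs; lra. }
  assert (Hdg : forall r, Rmin e (e + h) <= r <= Rmax e (e + h) -> r <> e ->
    is_derive g r (dg r)).
  { intros r Hr Hne. apply Hder. split; [apply Rabs_pos_lt; lra|].
    specialize (Hin r Hr). lra. }
  (* The mean value theorem needs the derivative only strictly between [e] and [e + h], so the point
     [e] is avoided; continuity of [dg] then gives the limit of the difference quotients. *)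
  destruct (MVT_gen g e (e + h) dg) as [c [Hc E]].
  - intros r Hr. apply Hdg; [lra|]. intros ->. revert Hr. unfold Rmin, Rmax.
    destruct Rle_dec; lra.
  - intros r Hr. apply continuity_pt_filterlim.
    destruct (Req_dec r e) as [->|Hne]; [exact Cg|].
    apply (is_derive_continuous _ _ (dg r)). now apply Hdg.
  - replace ((g (e + h) - g e) / h) with (dg c) by (rewrite E; field; lra).
    apply (H1 c). change (Rabs (c - e) < d1). specialize (Hin c Hc). lra.
Qed.

(** The value at [e] is taken from [g], the piece that solves the system there; [f] is only known to
    have a limit at [e]. *)
Definition glue (e : R) (f g : R -> R) (s : R) : R :=
  if Rlt_dec s e then f s else g s.

Lemma glue_left (e : R) (f g : R -> R) (s : R) : s < e -> glue e f g s = f s.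
Proof. intros H. unfold glue. now destruct Rlt_dec. Qed.

Lemma glue_right (e : R) (f g : R -> R) (s : R) : e <= s -> glue e f g s = g s.
Proof. intros H. unfold glue. destruct Rlt_dec; [lra | easy]. Qed.

Lemma glue_continuous (a : Rbar) (e : R) (f g : R -> R) (s0 : R) : in_itv a e s0 ->
  filterlim f (toward a e e) (locally (g e)) -> continuous g e ->
  continuous (glue e f g) e.
Proof.
  intros H0 Hf Hg. unfold continuous. rewrite (glue_right e f g e) by lra.
  intros P HP. specialize (Hf P HP). specialize (Hg P HP).
  unfold filtermap in *.
  apply (toward_right_iff a e s0) in Hf; [|exact H0].
  destruct Hf as [s1 [[H1a H1] Hf]]. simpl in H1.
  generalize (filter_and _ _ Hg (open_gt s1 e H1)). apply filter_imp.
  intros s [Hs Hs1]. unfold glue. destruct Rlt_dec as [Hlt|Hge]; [|exact Hs].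
  apply Hf; [|exact Hs1]. split; [|exact Hlt].
  now apply Rbar_lt_trans with s1.
Qed.

Lemma glue_derive_left (e : R) (f g : R -> R) (s l : R) : s < e ->
  is_derive f s l -> is_derive (glue e f g) s l.
Proof.
  intros H. apply is_derive_ext_loc. generalize (open_lt e s H).
  apply filter_imp. intros r Hr. symmetry. now apply glue_left.
Qed.

Lemma glue_derive_right (e : R) (f g : R -> R) (s l : R) : e < s ->
  is_derive g s l -> is_derive (glue e f g) s l.
Proof.
  intros H. apply is_derive_ext_loc. generalize (open_gt e s H).
  apply filter_imp. intros r Hr. symmetry. apply glue_right. lra.
Qed.

(** A solution started from the limit values can be glued on. The result is continuous at [b] and
    solves the system on both sides, hence also at [b], because the right-hand sides are continuous
    there. This extends the maximal solution to [b + d]. *)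
Lemma maximal_no_regular_limit (a : Rbar) (b : R) (x y theta : R -> R)
  (x0 y0 theta0 xb yb tb : R) :
  maximal_solution a b x y theta x0 y0 theta0 ->
  filterlim x (toward a b b) (locally xb) ->
  filterlim y (toward a b b) (locally yb) ->
  filterlim theta (toward a b b) (locally tb) ->
  0 < yb -> sin tb <> 0 -> False.
Proof.
  intros [H0 Hsol _ _ _ Hmax] Hx Hy Ht Hyb Htb.
  destruct (soliton_local_existence b xb yb tb Hyb Htb)
    as [d [x1 [y1 [t1 [Hd [Ex [Ey [Et Hs1]]]]]]]].
  assert (Hb : in_itv (b - d) (b + d) b) by (split; simpl; lra).
  set (X := glue b x x1). set (Y := glue b y y1). set (T := glue b theta t1).
  assert (CX : continuous X b).
  { apply (glue_continuous a b x x1 0 H0); [now rewrite Ex|].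
    exact (is_derive_continuous _ _ _ (sol_x' _ _ _ _ _ Hs1 b Hb)). }
  assert (CY : continuous Y b).
  { apply (glue_continuous a b y y1 0 H0); [now rewrite Ey|].
    exact (is_derive_continuous _ _ _ (sol_y' _ _ _ _ _ Hs1 b Hb)). }
  assert (CT : continuous T b).
  { apply (glue_continuous a b theta t1 0 H0); [now rewrite Et|].
    exact (is_derive_continuous _ _ _ (sol_theta' _ _ _ _ _ Hs1 b Hb)). }
  assert (Yb : Y b = yb) by (unfold Y; rewrite glue_right by lra; exact Ey).
  assert (Tb : T b = tb) by (unfold T; rewrite glue_right by lra; exact Et).
  assert (Ccos : continuous (fun s => cos (T s)) b)
    by (apply continuous_comp; [exact CT | apply continuous_cos]).
  assert (Csin : continuous (fun s => sin (T s)) b)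
    by (apply continuous_comp; [exact CT | apply continuous_sin]).
  assert (Cinv : forall f, continuous f b -> f b <> 0 -> continuous (fun s => / f s) b).
  { intros f Cf Hf. apply continuous_comp; [exact Cf|].
    now apply continuous_Rinv. }
  assert (Cth : continuous (fun s => 1 / sin (T s) - cos (T s) / Y s) b).
  { apply (continuous_minus (fun s => 1 / sin (T s)) (fun s => cos (T s) / Y s)).
    - apply (continuous_mult (fun _ => 1) (fun s => / sin (T s)));
        [apply continuous_const|]. apply Cinv; [exact Csin | now rewrite Tb].
    - apply (continuous_mult (fun s => cos (T s)) (fun s => / Y s)); [exact Ccos|].
      apply Cinv; [exact CY | rewrite Yb; lra]. }
  assert (Hin1 : forall s, in_itv a (b + d) s -> s < b -> in_itv a b s).
  { intros s [Ha _] Hs. split; [exact Ha | exact Hs]. }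
  assert (Hin2 : forall s, in_itv a (b + d) s -> b <= s -> in_itv (b - d) (b + d) s).
  { intros s [_ Hs] Hbs. simpl in Hs. split; simpl; lra. }
  (* Since 0 lies in the interval, [b] is positive, and points closer than [b] to [b] lie to the
     right of 0, hence of [a]. *)
  set (d' := Rmin d b).
  assert (Hd' : 0 < d').
  { apply Rmin_pos; [exact Hd|]. destruct H0 as [_ H0]. simpl in H0. lra. }
  assert (Hin3 : forall s, 0 < Rabs (s - b) < d' -> s <> b /\ in_itv a (b + d) s).
  { intros s [Hs1' Hs2]. unfold d' in Hs2.
    pose proof (Rmin_l d b). pose proof (Rmin_r d b).
    split; [intros ->; rewrite Rminus_eq_0, Rabs_R0 in Hs1'; lra|].
    apply Rabs_lt_between in Hs2. destruct H0 as [Ha _]. split; [|simpl; lra].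
    apply Rbar_lt_trans with 0; [exact Ha | simpl; lra]. }
  assert (HE : soliton_system a (b + d) X Y T).
  { assert (DX : forall s, s <> b -> in_itv a (b + d) s -> is_derive X s (cos (T s))).
    { intros s Hne Hs. unfold X, T. destruct (Rlt_le_dec s b) as [Hlt|Hge].
      - rewrite glue_left by exact Hlt. apply glue_derive_left; [exact Hlt|].
        apply (sol_x' _ _ _ _ _ Hsol). now apply Hin1.
      - rewrite glue_right by exact Hge. apply glue_derive_right; [lra|].
        apply (sol_x' _ _ _ _ _ Hs1). now apply Hin2. }
    assert (DY : forall s, s <> b -> in_itv a (b + d) s -> is_derive Y s (sin (T s))).
    { intros s Hne Hs. unfold Y, T. destruct (Rlt_le_dec s b) as [Hlt|Hge].
      - rewrite glue_left by exact Hlt. apply glue_derive_left; [exact Hlt|].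
        apply (sol_y' _ _ _ _ _ Hsol). now apply Hin1.
      - rewrite glue_right by exact Hge. apply glue_derive_right; [lra|].
        apply (sol_y' _ _ _ _ _ Hs1). now apply Hin2. }
    assert (DT : forall s, s <> b -> in_itv a (b + d) s ->
      is_derive T s (1 / sin (T s) - cos (T s) / Y s)).
    { intros s Hne Hs. unfold Y, T. destruct (Rlt_le_dec s b) as [Hlt|Hge].
      - rewrite !glue_left by exact Hlt. apply glue_derive_left; [exact Hlt|].
        apply (sol_theta' _ _ _ _ _ Hsol). now apply Hin1.
      - rewrite !glue_right by exact Hge. apply glue_derive_right; [lra|].
        apply (sol_theta' _ _ _ _ _ Hs1). now apply Hin2. }
    constructor; intros s Hs.
    - unfold Y. destruct (Rlt_le_dec s b) as [Hlt|Hge].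
      + rewrite glue_left by exact Hlt. apply (sol_y_pos _ _ _ _ _ Hsol). now apply Hin1.
      + rewrite glue_right by exact Hge. apply (sol_y_pos _ _ _ _ _ Hs1). now apply Hin2.
    - unfold T. destruct (Rlt_le_dec s b) as [Hlt|Hge].
      + rewrite glue_left by exact Hlt. apply (sol_sin _ _ _ _ _ Hsol). now apply Hin1.
      + rewrite glue_right by exact Hge. apply (sol_sin _ _ _ _ _ Hs1). now apply Hin2.
    - destruct (Req_dec s b) as [->|Hne]; [|now apply DX].
      apply (is_derive_of_punctured X (fun s => cos (T s)) b d'); try assumption.
      intros s [H1 H2]%Hin3. now apply DX.
    - destruct (Req_dec s b) as [->|Hne]; [|now apply DY].
      apply (is_derive_of_punctured Y (fun s => sin (T s)) b d'); try assumption.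
      intros s [H1 H2]%Hin3. now apply DY.
    - destruct (Req_dec s b) as [->|Hne]; [|now apply DT].
      apply (is_derive_of_punctured T (fun s => 1 / sin (T s) - cos (T s) / Y s) b d');
        try assumption.
      intros s [H1 H2]%Hin3. now apply DT. }
  destruct (Hmax a (b + d) X Y T) as [_ Hc].
  - apply Rbar_le_refl.
  - simpl; lra.
  - exact HE.
  - intros s [_ Hs]. simpl in Hs. unfold X, Y, T. now rewrite !glue_left.
  - injection Hc. lra.
Qed.

(** * Behaviour at the ends of a maximal solution *)

(** The factor [1 / sin (theta s)] of theta' cancels against the derivative of the cosine, so
    nothing blows up as the tangent becomes horizontal. *)
Lemma derive_cos_theta (a b : Rbar) (x y theta : R -> R) (s : R) :
  soliton_system a b x y theta -> in_itv a b s ->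
  is_derive (fun s => cos (theta s)) s
    (-1 + cos (theta s) * sin (theta s) / y s).
Proof.
  intros [Hy Hs _ _ Ht] Hin. specialize (Hy s Hin). specialize (Hs s Hin).
  specialize (Ht s Hin).
  replace (-1 + _) with ((1 / sin (theta s) - cos (theta s) / y s) * - sin (theta s))
    by (field; split; lra).
  apply (is_derive_comp cos theta); [apply is_derive_cos | exact Ht].
Qed.

(** The quotient is a clock: while y stays between two positive constants it is bounded but
    decreases at a definite rate, which limits the arc length. *)
Lemma derive_cos_theta_over_y (a b : Rbar) (x y theta : R -> R) (s : R) :
  soliton_system a b x y theta -> in_itv a b s ->
  is_derive (fun s => cos (theta s) / y s) s (- / y s).
Proof.
  intros Hsol Hin.
  pose proof (derive_cos_theta _ _ _ _ _ _ Hsol Hin) as Hc.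
  pose proof (sol_y' _ _ _ _ _ Hsol s Hin) as Dy.
  pose proof (sol_y_pos _ _ _ _ _ Hsol s Hin) as Hy.
  replace (- / y s) with (((-1 + cos (theta s) * sin (theta s) / y s) * y s
    - cos (theta s) * sin (theta s)) / y s ^ 2) by (field; lra).
  apply (is_derive_div (fun s => cos (theta s)) y); [exact Hc | exact Dy | lra].
Qed.

Lemma sin2_eq (t : R) : sin t * sin t = 1 - cos t * cos t.
Proof. pose proof (sin2_cos2 t). unfold Rsqr in *. lra. Qed.

Lemma maximal_right_end_cos (a b : Rbar) (x y theta : R -> R)
  (x0 y0 theta0 s0 c C : R) :
  maximal_solution a b x y theta x0 y0 theta0 -> in_itv a b s0 -> 0 < c ->
  (forall s, in_itv a b s -> s0 <= s -> c <= y s <= C) ->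
  filterlim (fun s => cos (theta s)) (toward a b b) (locally (-1)) /\
  exists yb, c <= yb /\ filterlim y (toward a b b) (locally yb).
Proof.
  intros Hmax Hs0 Hc HyC. pose proof (max_sol _ _ _ _ _ _ _ _ Hmax) as Hsol.
  pose proof (toward_right_proper a b s0 Hs0) as Hproper.
  assert (Hsub : forall s r, in_itv a b s -> s0 <= r <= s -> in_itv a b r).
  { intros s r Hs. now apply in_itv_between. }
  assert (Hev : forall P : R -> Prop, (forall s, in_itv a b s -> s0 <= s -> P s) ->
    toward a b b P).
  { intros P HP. apply (toward_right_iff a b s0); [exact Hs0|]. exists s0.
    split; [exact Hs0|]. intros s Hs Hlt. apply HP; [exact Hs | lra]. }
  assert (Hcy : forall s, in_itv a b s -> s0 <= s -> 0 < / y s <= / c).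
  { intros s Hs Hle. specialize (HyC s Hs Hle). split.
    - apply Rinv_0_lt_compat. lra.
    - apply Rinv_le_contravar; lra. }
  assert (Hsc : forall t, Rabs (cos t * sin t) <= 1).
  { intros t. pose proof (sin2_eq t). apply Rabs_le. nra. }
  destruct b as [b| |].
  2: { exfalso.
    assert (HC : 0 < C) by (specialize (HyC s0 Hs0 (Rle_refl _)); lra).
    (* Over this length the quotient cos(theta) / y would drop by at least [3 * / c], although it
       stays in an interval of length [2 * / c]. *)
    set (t := s0 + C * (3 * / c)).
    assert (Hic : 0 < / c) by now apply Rinv_0_lt_compat.
    assert (Hlt : 0 < C * (3 * / c)) by (apply Rmult_lt_0_compat; lra).
    assert (Ht : in_itv a p_infty t).
    { split; [|easy]. apply Rbar_lt_le_trans with s0; [apply Hs0|simpl; unfold t; lra]. }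
    destruct (mvt_closed (fun s => cos (theta s) / y s) (fun s => - / y s) s0 t)
      as [r [Hr E]].
    - unfold t. lra.
    - intros r Hr. apply (derive_cos_theta_over_y _ _ _ _ _ _ Hsol).
      now apply (Hsub t).
    - assert (Hw : forall s, in_itv a p_infty s -> s0 <= s ->
        - / c <= cos (theta s) / y s <= / c).
      { intros s Hs Hle. specialize (Hcy s Hs Hle). pose proof (COS_bound (theta s)).
        unfold Rdiv. nra. }
      pose proof (Hw s0 Hs0 (Rle_refl _)). pose proof (Hw t Ht ltac:(unfold t; lra)).
      assert (/ C <= / y r).
      { specialize (HyC r (Hsub t r Ht Hr) ltac:(lra)). apply Rinv_le_contravar; lra. }
      assert (/ C * (t - s0) <= / y r * (t - s0))
        by (apply Rmult_le_compat_r; [unfold t; lra | assumption]).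
      assert (/ C * (t - s0) = 3 * / c) by (unfold t; field; lra).
      lra. }
  2: now destruct Hs0.
  destruct (derive_bound_limit_right a b y (fun s => sin (theta s)) s0 1 Hs0)
    as [yb Hyb].
  { intros s Hs. apply (sol_y' _ _ _ _ _ Hsol s Hs). }
  { intros s _ _. apply Rabs_le, SIN_bound. }
  destruct (derive_bound_limit_right a b (fun s => cos (theta s))
    (fun s => -1 + cos (theta s) * sin (theta s) / y s) s0 (1 + / c) Hs0) as [ub Hub].
  { intros s Hs. now apply (derive_cos_theta _ _ _ _ _ _ Hsol). }
  { intros s Hs Hle. specialize (Hcy s Hs Hle).
    eapply Rle_trans; [apply Rabs_triang|].
    rewrite Rabs_left by lra. unfold Rdiv. rewrite Rabs_mult, (Rabs_pos_eq (/ y s)) by lra.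
    specialize (Hsc (theta s)). pose proof (Rabs_pos (cos (theta s) * sin (theta s))). nra. }
  assert (Hcyb : c <= yb).
  { apply (filterlim_le (F := toward a b b) (fun _ => c) y c yb).
    - apply Hev. intros s Hs Hle. now apply HyC.
    - apply filterlim_const.
    - exact Hyb. }
  assert (Hub1 : ub <= 1).
  { apply (filterlim_le (F := toward a b b) (fun s => cos (theta s)) (fun _ => 1) ub 1).
    - apply Hev. intros s _ _. apply COS_bound.
    - exact Hub.
    - apply filterlim_const. }
  assert (Hub2 : -1 <= ub).
  { apply (filterlim_le (F := toward a b b) (fun _ => -1) (fun s => cos (theta s)) (-1) ub).
    - apply Hev. intros s _ _. apply COS_bound.
    - apply filterlim_const.
    - exact Hub. }
  assert (Hs2 : filterlim (fun s => sin (theta s) * sin (theta s)) (toward a b b)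
    (locally (1 - ub * ub))).
  { apply (filterlim_ext (fun s => 1 - cos (theta s) * cos (theta s))).
    { intros s. now rewrite sin2_eq. }
    apply (filterlim_comp _ _ _ (fun s => cos (theta s)) (fun u => 1 - u * u) _ _ _ Hub).
    apply (is_derive_continuous (fun u => 1 - u * u) ub (- (2 * ub))).
    auto_derive; [easy | ring]. }
  split; [|now exists yb].
  destruct (Req_dec ub (-1)) as [<-|Hm1]; [exact Hub|]. exfalso.
  (* If the limit were 1, then eventually |sin(theta)| < c <= y, so cos(theta) has a nonpositive
     derivative. A nonincreasing function with limit 1 is at least 1 at [s2], which forces
     sin(theta) = 0 there. *)
  destruct (Req_dec ub 1) as [->|Hp1].
  - assert (Hsmall : toward a b b (fun s => in_itv a b s /\ s0 < s /\
      sin (theta s) * sin (theta s) < c * c)).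
    { assert (H1 : 1 - 1 * 1 < c * c) by nra.
      generalize (filter_and _ _ (toward_right_after a b s0 Hs0) (filterlim_lt _ _ _ _ Hs2 H1)).
      apply filter_imp. intros s [[H2 H3] H4]. easy. }
    apply (toward_right_iff a b s0) in Hsmall; [|exact Hs0].
    destruct Hsmall as [s1 [Hs1 Hsm]].
    destruct (in_itv_greater _ _ _ Hs1) as [s2 [Hs2i Hlt2]].
    destruct (Hsm s2 Hs2i Hlt2) as [_ [Hs02 _]].
    assert (Hle : 1 <= cos (theta s2)).
    { apply (filterlim_le (F := toward a b b) (fun s => cos (theta s))
        (fun _ => cos (theta s2)) 1 (cos (theta s2))).
      - apply (toward_right_iff a b s0); [exact Hs0|]. exists s2. split; [exact Hs2i|].
        intros s Hs Hlt.
        destruct (mvt_closed (fun s => cos (theta s))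
          (fun s => -1 + cos (theta s) * sin (theta s) / y s) s2 s) as [r [Hr E]]; [lra| |].
        { intros r Hr. apply (derive_cos_theta _ _ _ _ _ _ Hsol).
          apply (Hsub s); [exact Hs | lra]. }
        assert (Hri : in_itv a b r) by (apply (Hsub s); [exact Hs | lra]).
        destruct (Hsm r Hri ltac:(lra)) as [_ [_ Hr2]].
        specialize (HyC r Hri ltac:(lra)). specialize (Hcy r Hri ltac:(lra)).
        assert (cos (theta r) * sin (theta r) <= c).
        { pose proof (COS_bound (theta r)). assert (Rabs (sin (theta r)) <= c).
          { apply Rabs_le. nra. }
          apply Rabs_le_between in H0. nra. }
        assert (cos (theta r) * sin (theta r) / y r <= 1).
        { apply Rle_div_l; lra. }
        nra.
      - exact Hub.
      - apply filterlim_const. }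
    apply (sol_sin _ _ _ _ _ Hsol s2 Hs2i).
    pose proof (COS_bound (theta s2)). pose proof (sin2_eq (theta s2)). nra.
  (* Here sin(theta)^2 has a positive limit and eventually exceeds half of it. Thus theta' is
     bounded, theta converges as well, and the end is regular. *)
  - assert (Hk : 0 < 1 - ub * ub) by nra.
    set (k := (1 - ub * ub) / 2).
    assert (Hk' : k < 1 - ub * ub) by (unfold k; lra).
    assert (Hk0 : 0 < k) by (unfold k; lra).
    pose proof (filter_and _ _ (toward_right_after a b s0 Hs0) (Hs2 _ (open_gt _ _ Hk')))
      as Hbig.
    apply (toward_right_iff a b s0) in Hbig; [|exact Hs0].
    destruct Hbig as [s1 [Hs1 Hbig]].
    destruct (in_itv_greater _ _ _ Hs1) as [s2 [Hs2i Hlt2]].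
    destruct (Hbig s2 Hs2i Hlt2) as [[_ Hs02] _].
    destruct (derive_bound_limit_right a b theta
      (fun s => 1 / sin (theta s) - cos (theta s) / y s) s2 (/ k + / c) Hs2i) as [tb Htb].
    { intros s Hs. apply (sol_theta' _ _ _ _ _ Hsol s Hs). }
    { intros s Hs Hle. destruct (Hbig s Hs ltac:(lra)) as [_ Hq].
      specialize (Hcy s Hs ltac:(lra)).
      assert (Hn : sin (theta s) <> 0) by exact (sol_sin _ _ _ _ _ Hsol s Hs).
      unfold Rminus. eapply Rle_trans; [apply Rabs_triang|]. rewrite Rabs_Ropp.
      apply Rplus_le_compat.
      - replace (1 / sin (theta s)) with (sin (theta s) * / (sin (theta s) * sin (theta s)))
          by (field; exact Hn).
        rewrite Rabs_mult, <- (Rmult_1_l (/ k)).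
        apply Rmult_le_compat; try apply Rabs_pos.
        + apply Rabs_le, SIN_bound.
        + rewrite Rabs_pos_eq by (left; apply Rinv_0_lt_compat; lra).
          apply Rinv_le_contravar; lra.
      - unfold Rdiv. rewrite Rabs_mult, <- (Rmult_1_l (/ c)).
        apply Rmult_le_compat; try apply Rabs_pos.
        + apply Rabs_le, COS_bound.
        + rewrite Rabs_pos_eq by lra. lra. }
    destruct (derive_bound_limit_right a b x (fun s => cos (theta s)) s0 1 Hs0)
      as [xb Hxb].
    { intros s Hs. apply (sol_x' _ _ _ _ _ Hsol s Hs). }
    { intros s _ _. apply Rabs_le, COS_bound. }
    apply (maximal_no_regular_limit a b x y theta x0 y0 theta0 xb yb tb Hmax Hxb Hyb Htb);
      [lra|].
    assert (Ecos : cos tb = ub).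
    { apply (filterlim_locally_unique (F := toward a b b) (fun s => cos (theta s)));
        [|exact Hub].
      apply (filterlim_comp _ _ _ theta cos _ _ _ Htb). apply continuous_cos. }
    intros E. pose proof (sin2_eq tb). rewrite E, Ecos in *. lra.
Qed.

(** The shift [p] is left open because both signs of [PI] occur: competitors of the reversed curve
    are turned back with [- PI], so that theta is recovered exactly and not merely modulo a full
    turn. *)
Lemma soliton_system_reverse (a b : Rbar) (x y theta : R -> R) (p : R) :
  sin p = 0 -> cos p = -1 -> soliton_system a b x y theta ->
  soliton_system (Rbar_opp b) (Rbar_opp a) (fun s => x (- s)) (fun s => y (- s))
    (fun s => theta (- s) + p).
Proof.
  intros Sp Cp Hsol.
  assert (Es : forall t, sin (t + p) = - sin t)
    by (intros t; rewrite sin_plus, Sp, Cp; ring).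
  assert (Ec : forall t, cos (t + p) = - cos t)
    by (intros t; rewrite cos_plus, Sp, Cp; ring).
  assert (D : forall (f : R -> R) (s l : R), is_derive f (- s) l ->
    is_derive (fun s => f (- s)) s (- l)).
  { intros f s l Hf. replace (- l) with (- 1 * l) by ring.
    apply (is_derive_comp f Ropp); [exact Hf|]. auto_derive; [easy | ring]. }
  constructor; intros s Hs%in_itv_opp.
  - now apply (sol_y_pos _ _ _ _ _ Hsol).
  - rewrite Es. intros E. apply (sol_sin _ _ _ _ _ Hsol _ Hs). lra.
  - rewrite Ec. now apply D, (sol_x' _ _ _ _ _ Hsol).
  - rewrite Es. now apply D, (sol_y' _ _ _ _ _ Hsol).
  - pose proof (sol_sin _ _ _ _ _ Hsol _ Hs) as Hn.
    pose proof (sol_y_pos _ _ _ _ _ Hsol _ Hs) as Hy.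
    rewrite Es, Ec.
    replace (1 / - sin (theta (- s)) - - cos (theta (- s)) / y (- s))
      with (- (1 / sin (theta (- s)) - cos (theta (- s)) / y (- s)) + 0)
      by (field; split; lra).
    apply (is_derive_plus (fun s => theta (- s)) (fun _ => p));
      [|exact (is_derive_const (V := R_NormedModule) p s)].
    now apply (D theta), (sol_theta' _ _ _ _ _ Hsol).
Qed.

(* The curve run backwards has tangent angle theta + PI. *)
Lemma maximal_solution_reverse (a b : Rbar) (x y theta : R -> R) (x0 y0 theta0 : R) :
  maximal_solution a b x y theta x0 y0 theta0 ->
  maximal_solution (Rbar_opp b) (Rbar_opp a) (fun s => x (- s)) (fun s => y (- s))
    (fun s => theta (- s) + PI) x0 y0 (theta0 + PI).
Proof.
  intros [H0 Hsol Hx Hy Ht Hmax]. constructor; rewrite ?Ropp_0; try congruence.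
  - apply in_itv_opp. now rewrite Ropp_0.
  - apply soliton_system_reverse; [apply sin_PI | apply cos_PI | exact Hsol].
  - intros a' b' x1 y1 t1 Ha Hb Hs1 E.
    destruct (Hmax (Rbar_opp b') (Rbar_opp a') (fun s => x1 (- s)) (fun s => y1 (- s))
      (fun s => t1 (- s) + - PI)) as [E1 E2].
    + rewrite <- (Rbar_opp_involutive a). now apply Rbar_opp_le.
    + rewrite <- (Rbar_opp_involutive b). now apply Rbar_opp_le.
    + apply soliton_system_reverse; [| |exact Hs1].
      * rewrite sin_neg, sin_PI. ring.
      * rewrite cos_neg. apply cos_PI.
    + intros s Hs. destruct (E (- s)) as [-> [-> ->]].
      { apply in_itv_opp. now rewrite Ropp_involutive. }
      rewrite Ropp_involutive. repeat split. ring.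
    + rewrite <- E1, <- E2, !Rbar_opp_involutive. easy.
Qed.

(** Reversal changes the sign of the cosine, so the limit -1 at a right end becomes 1 at a left
    end. *)
Lemma maximal_left_end_cos (a b : Rbar) (x y theta : R -> R)
  (x0 y0 theta0 s0 c C : R) :
  maximal_solution a b x y theta x0 y0 theta0 -> in_itv a b s0 -> 0 < c ->
  (forall s, in_itv a b s -> s <= s0 -> c <= y s <= C) ->
  filterlim (fun s => cos (theta s)) (toward a b a) (locally 1).
Proof.
  intros Hmax%maximal_solution_reverse Hs0 Hc HyC.
  destruct (maximal_right_end_cos _ _ _ _ _ _ _ _ (- s0) c C Hmax) as [H _]; try easy.
  - apply in_itv_opp. now rewrite Ropp_involutive.
  - intros s Hs%in_itv_opp Hle. apply HyC; [exact Hs | lra].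
  - apply filterlim_toward_left_reverse.
    apply (filterlim_ext (fun s => - cos (theta (- s) + PI))).
    { intros s. rewrite neg_cos. ring. }
    replace 1 with (- (-1)) by ring.
    refine (filterlim_comp _ _ _ _ Ropp _ _ _ H _).
    apply (filterlim_opp (V := R_NormedModule)).
Qed.

(** A competitor of the translated solution is carried back by [- s0] and there competes with the
    original one. *)
Lemma maximal_solution_translate (a b : Rbar) (x y theta : R -> R)
  (x0 y0 theta0 s0 : R) :
  maximal_solution a b x y theta x0 y0 theta0 -> in_itv a b s0 ->
  maximal_solution (Rbar_minus a s0) (Rbar_minus b s0)
      (fun s => x (s + s0) - x s0) (fun s => y (s + s0))
      (fun s => theta (s + s0)) 0 (y s0) (theta s0).
Proof.
  intros [H0 Hsol _ _ _ Hmax] Hs0.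
  assert (Hin : forall a b (r s : R), in_itv (Rbar_minus a r) (Rbar_minus b r) s <->
    in_itv a b (s + r)).
  { clear. intros a b r s. unfold in_itv.
    destruct a, b; simpl; split; intros [H1 H2]; split; try easy; lra. }
  assert (Hinv : forall c (r : R), Rbar_minus (Rbar_minus c r) (- r) = c).
  { clear. intros [c| |] r; simpl; try easy. f_equal. ring. }
  assert (Hle : forall c d (r : R), Rbar_le c d -> Rbar_le (Rbar_minus c r) (Rbar_minus d r)).
  { clear. intros [c| |] [d| |] r; simpl; try easy; lra. }
  assert (Hsys : forall a b x y theta (r k : R), soliton_system a b x y theta ->
    soliton_system (Rbar_minus a r) (Rbar_minus b r)
      (fun s => x (s + r) + k) (fun s => y (s + r)) (fun s => theta (s + r))).
  { clear - Hin. intros a b x y theta r k [H1 H2 H3 H4 H5].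
    assert (D : forall (f : R -> R) (s l : R), is_derive f (s + r) l ->
      is_derive (fun s => f (s + r)) s l).
    { intros f s l Hf. rewrite <- (Rmult_1_l l).
      apply (is_derive_comp f (fun s => s + r)); [exact Hf|].
      auto_derive; [easy | ring]. }
    constructor; intros s Hs%Hin.
    - now apply H1.
    - now apply H2.
    - rewrite <- (Rplus_0_r (cos _)).
      apply (is_derive_plus (fun s => x (s + r)) (fun _ => k));
        [|exact (is_derive_const (V := R_NormedModule) k s)].
      now apply (D x), H3.
    - now apply D, H4.
    - now apply (D theta), H5. }
  constructor; rewrite ?Rplus_0_l; try easy.
  - apply Hin. now rewrite Rplus_0_l.
  - now apply Hsys.
  - apply Rminus_eq_0.
  - intros a' b' x1 y1 t1 Ha Hb Hs1 E.
    destruct (Hmax (Rbar_minus a' (- s0)) (Rbar_minus b' (- s0))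
      (fun s => x1 (s + - s0) + x s0) (fun s => y1 (s + - s0)) (fun s => t1 (s + - s0)))
      as [E1 E2].
    + rewrite <- (Hinv a s0). now apply Hle.
    + rewrite <- (Hinv b s0). now apply Hle.
    + now apply Hsys.
    + intros s Hs. destruct (E (s + - s0)) as [-> [-> ->]].
      { apply Hin. now replace (s + - s0 + s0) with s by ring. }
      replace (s + - s0 + s0) with s by ring. repeat split. ring.
    + rewrite <- E1, <- E2. split.
      * rewrite <- (Hinv a' (- s0)) at 1. now rewrite Ropp_involutive.
      * rewrite <- (Hinv b' (- s0)) at 1. now rewrite Ropp_involutive.
Qed.

(** * Solitons with theta in (0, PI) *)

Lemma ivt_in_itv (a b : Rbar) (f : R -> R) (s t v : R) :
  (forall r, in_itv a b r -> continuous f r) ->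
  in_itv a b s -> in_itv a b t -> f s < v < f t ->
  exists r, in_itv a b r /\ f r = v.
Proof.
  intros Hf Hs Ht Hv.
  assert (Hc : forall p q r, in_itv a b p -> in_itv a b q -> p <= r <= q ->
    continuity_pt f r).
  { intros p q r Hp Hq Hr. apply continuity_pt_filterlim, Hf.
    now apply (in_itv_between a b p r q). }
  destruct (Rtotal_order s t) as [Hlt|[->|Hgt]]; [| lra |].
  - destruct (Ranalysis5.IVT_interv (fun r => f r - v) s t) as [r [Hr E]]; try lra.
    + intros r Hr. apply continuity_pt_minus; [now apply (Hc s t)|].
      now apply continuity_pt_const.
    + exists r. split; [now apply (in_itv_between a b s r t) | lra].
  - destruct (Ranalysis5.IVT_interv (fun r => v - f r) t s) as [r [Hr E]]; try lra.
    + intros r Hr. apply continuity_pt_minus; [|now apply (Hc t s)].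
      now apply continuity_pt_const.
    + exists r. split; [now apply (in_itv_between a b t r s) | lra].
Qed.

(** * Sign persistence, inverse functions and concavity *)

Lemma negative_before_upcrossing (f : R -> R) (l d : R) :
  is_derive f l d -> f l <= 0 -> (f l = 0 -> 0 < d) ->
  exists e, 0 < e /\ forall r, l - e < r < l -> f r < 0.
Proof.
  intros Hd [Hneg|Hz] Hpos.
  - destruct (is_derive_continuous _ _ _ Hd _ (open_lt 0 (f l) Hneg)) as [[e He] H].
    exists e. split; [exact He|]. intros r Hr. apply (H r).
    change (Rabs (r - l) < e). rewrite Rabs_left; lra.
  - specialize (Hpos Hz). apply is_derive_Reals in Hd.
    destruct (Hd (d / 2) ltac:(lra)) as [[e He] H]. simpl in H.
    exists e. split; [exact He|]. intros r Hr.
    specialize (H (r - l) ltac:(lra) ltac:(rewrite Rabs_left; lra)).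
    replace (l + (r - l)) with r in H by ring. rewrite Hz, Rminus_0_r in H.
    apply Rabs_lt_between in H.
    assert (Hq : 0 < f r / (r - l)) by lra.
    replace (f r) with (f r / (r - l) * (r - l)) by (field; lra). nra.
Qed.

(** Let [l] be the supremum of the times up to which [f] is positive. If [f l > 0], positivity
    continues beyond [l], or [l = t], against the assumption. If [f l <= 0], then [f] is negative
    just before [l], at a zero because the derivative is positive there. *)
Lemma positive_persists (f f' : R -> R) (s t : R) : s <= t ->
  (forall r, s <= r <= t -> is_derive f r (f' r)) -> 0 < f s ->
  (forall r, s <= r <= t -> f r = 0 -> 0 < f' r) -> 0 < f t.
Proof.
  intros Hst Hd Hs Hz. apply Rnot_le_lt. intros Ht.
  destruct (completeness (fun r => s <= r <= t /\ forall q, s <= q <= r -> 0 < f q))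
    as [l [Hub Hlub]].
  - exists t. intros r [Hr _]. lra.
  - exists s. split; [lra|]. intros q Hq. now replace q with s by lra.
  - assert (Hsl : s <= l).
    { apply Hub. split; [lra|]. intros q Hq. now replace q with s by lra. }
    assert (Hlt : l <= t) by (apply Hlub; intros r [Hr _]; lra).
    assert (Happ : forall e, 0 < e -> exists r, l - e < r /\ s <= r <= t /\
      forall q, s <= q <= r -> 0 < f q).
    { intros e He. apply NNPP. intros N.
      assert (l <= l - e); [|lra]. apply Hlub. intros r [Hr1 Hr2].
      apply Rnot_lt_le. intros C. apply N. exists r. now split. }
    pose proof (Hd l (conj Hsl Hlt)) as Dl.
    destruct (Rlt_le_dec 0 (f l)) as [Hpos|Hneg].
    + destruct (is_derive_continuous _ _ _ Dl _ (open_gt 0 (f l) Hpos)) as [[e He] H].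
      destruct (Happ e He) as [r [Hr1 [Hr2 Hr3]]].
      assert (Hl' : l < t) by (destruct (Req_dec l t) as [E|]; [rewrite E in Hpos|]; lra).
      set (p := Rmin t (l + e / 2)).
      assert (Hp : l < p /\ p <= t /\ p <= l + e / 2).
      { unfold p, Rmin. destruct Rle_dec; lra. }
      assert (p <= l); [|lra].
      apply Hub. split; [lra|]. intros q Hq.
      destruct (Rle_lt_dec q r) as [Hqr|Hqr]; [apply Hr3; lra|].
      apply (H q). change (Rabs (q - l) < e). apply Rabs_lt_between. lra.
    + destruct (negative_before_upcrossing f l (f' l) Dl Hneg) as [e [He H]].
      { apply Hz. lra. }
      destruct (Happ e He) as [r [Hr1 [Hr2 Hr3]]].
      assert (Hrl : r <= l) by (apply Hub; now split).
      pose proof (Hr3 r ltac:(lra)).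
      destruct Hrl as [Hrl|Hrl].
      * specialize (H r ltac:(lra)). lra.
      * subst r. lra.
Qed.

Lemma is_derive_inverse (f g : R -> R) (lb ub t l : R) : lb < t < ub ->
  continuous g t -> (forall r, g lb <= r <= g ub -> ex_derive f r) ->
  (forall r, lb <= r <= ub -> f (g r) = r) -> g lb <= g t <= g ub ->
  is_derive f (g t) l -> l <> 0 -> is_derive g t (/ l).
Proof.
  intros Ht Cg Hf Hid Hgt Hl Hl0. apply is_derive_Reals.
  assert (Prf : forall r, g lb <= r <= g ub -> derivable_pt f r).
  { intros r Hr. now apply ex_derive_Reals_0, Hf. }
  assert (E : derive_pt f (g t) (Prf (g t) Hgt) = l).
  { apply derive_pt_eq_0. now apply is_derive_Reals. }
  rewrite <- E, <- (Rmult_1_l (/ _)).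
  apply (Ranalysis5.derivable_pt_lim_recip_interv f g lb ub t Prf); try lra.
  - now apply continuity_pt_filterlim.
  - exact Hid.
Qed.

Lemma concave_of_derive_nonincreasing (f f' : R -> R) (m M : R) :
  (forall t, m < t < M -> is_derive f t (f' t)) ->
  (forall s t, m < s -> s <= t -> t < M -> f' t <= f' s) -> concave_on f m M.
Proof.
  intros Hd Hm.
  assert (H : forall u v t, m < u < M -> m < v < M -> u <= v -> 0 <= t <= 1 ->
    t * f u + (1 - t) * f v <= f (t * u + (1 - t) * v)).
  { intros u v t Hu Hv Huv Ht. set (p := t * u + (1 - t) * v).
    assert (Hp1 : p - u = (1 - t) * (v - u)) by (unfold p; ring).
    assert (Hp2 : v - p = t * (v - u)) by (unfold p; ring).
    assert (Hp : u <= p <= v) by nra.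
    destruct (mvt_closed f f' u p) as [c1 [Hc1 E1]]; [lra|intros; apply Hd; lra|].
    destruct (mvt_closed f f' p v) as [c2 [Hc2 E2]]; [lra|intros; apply Hd; lra|].
    pose proof (Hm c1 c2 ltac:(lra) ltac:(lra) ltac:(lra)) as Hc.
    rewrite Hp1 in E1. rewrite Hp2 in E2.
    assert (0 <= t * (1 - t) * (v - u) * (f' c1 - f' c2)).
    { repeat apply Rmult_le_pos; lra. }
    replace (f u) with (f p - f' c1 * ((1 - t) * (v - u))) by lra.
    replace (f v) with (f p + f' c2 * (t * (v - u))) by lra.
    lra. }
  intros u v t Hu Hv Ht. destruct (Rle_lt_dec u v) as [Huv|Hvu]; [now apply H|].
  pose proof (H v u (1 - t) Hv Hu ltac:(lra) ltac:(lra)) as H1.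
  replace (1 - (1 - t)) with t in H1 by ring.
  replace (t * u + (1 - t) * v) with ((1 - t) * v + t * u) by ring. lra.
Qed.

Lemma filterlim_sin_of_cos {T : Type} (F : (T -> Prop) -> Prop) {FF : Filter F}
  (theta : T -> R) (v : R) : v * v = 1 ->
  filterlim (fun s => cos (theta s)) F (locally v) ->
  filterlim (fun s => sin (theta s)) F (locally 0).
Proof.
  intros Hv Hc. apply filterlim_locally. intros eps.
  assert (H : filterlim (fun s => 1 - cos (theta s) * cos (theta s)) F
    (locally (1 - v * v))).
  { apply (filterlim_comp _ _ _ (fun s => cos (theta s)) (fun u => 1 - u * u) _ _ _ Hc).
    apply (is_derive_continuous (fun u => 1 - u * u) v (- (2 * v))).
    auto_derive; [easy | ring]. }
  assert (He : 1 - v * v < eps * eps)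
    by (rewrite Hv; pose proof (cond_pos eps); nra).
  generalize (filterlim_lt _ _ _ _ H He). apply filter_imp. intros s Hs.
  rewrite <- sin2_eq in Hs. change (Rabs (sin (theta s) - 0) < eps).
  pose proof (cond_pos eps). rewrite Rminus_0_r. apply Rabs_lt_between. nra.
Qed.

(** The values 0 and PI are barriers: reaching either would make sin(theta) vanish, and a continuous
    theta cannot jump over them. *)
Lemma theta_range (a b : Rbar) (x y theta : R -> R) (s0 : R) :
  soliton_system a b x y theta -> in_itv a b s0 -> 0 < theta s0 < PI ->
  forall s, in_itv a b s -> 0 < theta s < PI.
Proof.
  intros Hsol H0 Ht s Hs. pose proof (sol_sin _ _ _ _ _ Hsol) as Hsin.
  assert (C : forall r, in_itv a b r -> continuous theta r).
  { intros r Hr. exact (is_derive_continuous _ _ _ (sol_theta' _ _ _ _ _ Hsol r Hr)). }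
  split; apply Rnot_le_lt; intros [Hlt|E].
  - destruct (ivt_in_itv a b theta s s0 0 C Hs H0 ltac:(lra)) as [r [Hr E]].
    apply (Hsin r Hr). rewrite E. apply sin_0.
  - apply (Hsin s Hs). rewrite E. apply sin_0.
  - destruct (ivt_in_itv a b theta s0 s PI C H0 Hs ltac:(lra)) as [r [Hr E]].
    apply (Hsin r Hr). rewrite E. apply sin_PI.
  - apply (Hsin s Hs). rewrite <- E. apply sin_PI.
Qed.

(** * Monotone height and the sign of the turning *)

Section Upward.

Variables (a b : Rbar) (x y theta : R -> R).
Hypothesis sol : soliton_system a b x y theta.
Hypothesis theta_0_PI : forall s, in_itv a b s -> 0 < theta s < PI.

Let y_pos := sol_y_pos _ _ _ _ _ sol.

Lemma sin_theta_pos (s : R) : in_itv a b s -> 0 < sin (theta s).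
Proof. intros Hs. apply sin_gt_0; now apply theta_0_PI. Qed.

Lemma y_increasing (s t : R) : in_itv a b s -> in_itv a b t -> s < t -> y s < y t.
Proof.
  intros Hs Ht Hlt.
  destruct (mvt_closed y (fun s => sin (theta s)) s t) as [c [Hc E]]; [lra| |].
  - intros r Hr. now apply (sol_y' _ _ _ _ _ sol), (in_itv_between a b s r t).
  - pose proof (sin_theta_pos c (in_itv_between a b s c t Hs Ht Hc)). nra.
Qed.

Lemma y_lt_inv (s t : R) : in_itv a b s -> in_itv a b t -> y s < y t -> s < t.
Proof.
  intros Hs Ht H. destruct (Rtotal_order s t) as [|[->|C]]; [easy|lra|].
  pose proof (y_increasing t s Ht Hs C). lra.
Qed.

Lemma y_inj (s t : R) : in_itv a b s -> in_itv a b t -> y s = y t -> s = t.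
Proof.
  intros Hs Ht H. destruct (Rtotal_order s t) as [C|[|C]]; [|easy|].
  - pose proof (y_increasing s t Hs Ht C). lra.
  - pose proof (y_increasing t s Ht Hs C). lra.
Qed.

(** Serves both ends: forward in time it bounds [ln (y t)], backward in time it makes cos(theta)
    positive wherever y is small enough. *)
Lemma cos_over_y_plus_ln_y_nonincreasing (s t : R) :
  in_itv a b s -> in_itv a b t -> s <= t ->
  cos (theta t) / y t + ln (y t) <= cos (theta s) / y s + ln (y s).
Proof.
  intros Hs Ht Hst.
  destruct (mvt_closed (fun s => cos (theta s) / y s + ln (y s))
    (fun s => - / y s + sin (theta s) * / y s) s t Hst) as [c [Hc E]].
  - intros r Hr. pose proof (in_itv_between a b s r t Hs Ht Hr) as Hin.
    apply (is_derive_plus (fun s => cos (theta s) / y s) (fun s => ln (y s))).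
    + exact (derive_cos_theta_over_y _ _ _ _ _ _ sol Hin).
    + apply (is_derive_comp ln y); [|exact (sol_y' _ _ _ _ _ sol r Hin)].
      now apply is_derive_ln, y_pos.
  - assert (Hp : 0 < / y c)
      by now apply Rinv_0_lt_compat, y_pos, (in_itv_between a b s c t).
    pose proof (SIN_bound (theta c)).
    assert ((- / y c + sin (theta c) * / y c) * (t - s) <= 0); [|lra].
    apply Rmult_le_0_r; [|lra]. nra.
Qed.

Lemma y_left_limit (s0 : R) : in_itv a b s0 -> exists m, 0 <= m /\
  filterlim y (toward a b a) (locally m) /\ forall s, in_itv a b s -> m < y s.
Proof.
  intros H0.
  destruct (monotone_limit_right (Rbar_opp b) (Rbar_opp a) (fun s => - y (- s)) (- s0) 0)
    as [l [Hl Hle]].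
  - apply in_itv_opp. now rewrite Ropp_involutive.
  - intros s t Ht%in_itv_opp Hst.
    destruct (Req_dec s t) as [->|Hne]; [lra|].
    assert (Hs : in_itv a b (- s)) by (apply (in_itv_between a b (- t) _ s0); [easy|easy|lra]).
    pose proof (y_increasing (- t) (- s) Ht Hs ltac:(lra)). lra.
  - intros s Hs%in_itv_opp _. pose proof (y_pos _ Hs). lra.
  - assert (Hlim : filterlim y (toward a b a) (locally (- l))).
    { apply filterlim_toward_left_reverse.
      apply (filterlim_ext (fun s => - - y (- s))); [intros; ring|].
      refine (filterlim_comp _ _ _ _ Ropp _ _ _ Hl _).
      apply (filterlim_opp (V := R_NormedModule)). }
    assert (Hweak : forall s, in_itv a b s -> s <= s0 -> - l <= y s).
    { intros s Hs Hle0. specialize (Hle (- s)). rewrite Ropp_involutive in Hle.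
      assert (- y s <= l); [|lra].
      apply Hle; [|lra]. apply in_itv_opp. now rewrite Ropp_involutive. }
    exists (- l). split; [|split; [exact Hlim|]].
    + apply Rnot_lt_le. intros Hn.
      pose proof (filterlim_lt _ _ _ _ Hlim Hn) as Hev.
      apply (toward_left_iff a b s0) in Hev; [|exact H0].
      destruct Hev as [s1 [Hs1 H]].
      destruct (in_itv_less _ _ _ Hs1) as [t [Ht Htl]].
      specialize (H t Ht Htl). pose proof (y_pos t Ht). lra.
    + intros s Hs.
      (* Passing through a still earlier point makes the inequality strict. *)
      destruct (in_itv_less a b (Rmin s s0)) as [t [Ht Htl]].
      { unfold Rmin. now destruct Rle_dec. }
      pose proof (Rmin_l s s0). pose proof (Rmin_r s s0).
      pose proof (Hweak t Ht ltac:(lra)).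
      pose proof (y_increasing t s Ht Hs ltac:(lra)). lra.
Qed.

Lemma y_right_strict_bound (M : R) : filterlim y (toward a b b) (locally M) ->
  forall s, in_itv a b s -> y s < M.
Proof.
  intros Hlim s Hs. destruct (in_itv_greater _ _ _ Hs) as [t [Ht Hst]].
  pose proof (y_increasing s t Hs Ht Hst).
  apply Rlt_le_trans with (y t); [easy|].
  pose proof (toward_right_proper a b s Hs) as Hp.
  apply (filterlim_le (F := toward a b b) (fun _ => y t) y (y t) M);
    [|apply filterlim_const|exact Hlim].
  apply (toward_right_iff a b s); [exact Hs|]. exists t. split; [exact Ht|].
  intros r Hr Hlt. left. now apply y_increasing.
Qed.

(* The curve turns left exactly where this is positive:
   y sin(theta) theta' = y - sin(theta) cos(theta). *)
Definition turning (s : R) : R := y s - sin (theta s) * cos (theta s).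

Lemma theta_derive_turning (s : R) : in_itv a b s ->
  is_derive theta s (turning s / (y s * sin (theta s))).
Proof.
  intros Hs. pose proof (y_pos s Hs). pose proof (sin_theta_pos s Hs).
  replace (turning s / (y s * sin (theta s)))
    with (1 / sin (theta s) - cos (theta s) / y s)
    by (unfold turning; field; lra).
  exact (sol_theta' _ _ _ _ _ sol s Hs).
Qed.

Lemma cos_derive_turning (s : R) : in_itv a b s ->
  is_derive (fun s => cos (theta s)) s (- (turning s / y s)).
Proof.
  intros Hs. pose proof (y_pos s Hs).
  replace (- (turning s / y s)) with (-1 + cos (theta s) * sin (theta s) / y s)
    by (unfold turning; field; lra).
  exact (derive_cos_theta _ _ _ _ _ _ sol Hs).
Qed.

(* At a zero of [turning] its derivative is sin(theta) > 0, so it can only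
   change sign upwards. *)
Lemma turning_nonpos_before (s t : R) : in_itv a b s -> in_itv a b t -> s <= t ->
  turning t <= 0 -> turning s <= 0.
Proof.
  intros Hs Ht Hst Hneg. apply Rnot_lt_le. intros Hpos.
  assert (0 < turning t); [|lra].
  apply (positive_persists turning (fun r => sin (theta r)
    - (turning r / (y r * sin (theta r))) * (cos (theta r) * cos (theta r)
      - sin (theta r) * sin (theta r))) s t Hst); [|exact Hpos|].
  - intros r Hr. pose proof (in_itv_between a b s r t Hs Ht Hr) as Hin.
    pose proof (theta_derive_turning r Hin) as D.
    set (d := turning r / (y r * sin (theta r))) in *.
    apply (is_derive_minus y (fun r => sin (theta r) * cos (theta r)));
      [exact (sol_y' _ _ _ _ _ sol r Hin)|].
    apply (is_derive_comp (fun u => sin u * cos u) theta); [|exact D].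
    auto_derive; [easy | ring].
  - intros r Hr E. rewrite E. unfold Rdiv. rewrite Rmult_0_l, Rmult_0_l, Rminus_0_r.
    now apply sin_theta_pos, (in_itv_between a b s r t).
Qed.

(** Height determines the parameter because y is strictly increasing; the value is meaningful only
    at heights that the curve attains. *)
Definition inverse_y (t : R) : R :=
  iota (T := R_CompleteSpace) (fun s => in_itv a b s /\ y s = t).

Lemma inverse_y_y (s : R) : in_itv a b s -> inverse_y (y s) = s.
Proof.
  intros Hs. apply (iota_unique (V := R_CompleteNormedModule)); [|easy].
  intros r [Hr E]. now apply y_inj.
Qed.

(** * The curve as a graph over its interval of heights *)

Section Graph.

Variables m M s0 : R.
Hypothesis s0_in : in_itv a b s0.
Hypothesis y_left : filterlim y (toward a b a) (locally m).
Hypothesis y_right : filterlim y (toward a b b) (locally M).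
Hypothesis y_range : forall s, in_itv a b s -> m < y s < M.

Lemma y_surjective (t : R) : m < t < M -> exists s, in_itv a b s /\ y s = t.
Proof.
  intros Ht.
  pose proof (filterlim_lt _ _ _ t y_left ltac:(lra)) as Hl.
  pose proof (filterlim_gt _ _ _ t y_right ltac:(lra)) as Hr.
  apply (toward_left_iff a b s0) in Hl; [|exact s0_in].
  apply (toward_right_iff a b s0) in Hr; [|exact s0_in].
  destruct Hl as [s1 [H1 Hl]]. destruct Hr as [s2 [H2 Hr]].
  destruct (in_itv_less _ _ _ H1) as [p [Hp Hp1]].
  destruct (in_itv_greater _ _ _ H2) as [q [Hq Hq1]].
  apply (ivt_in_itv a b y p q t); auto.
  intros r Hr'. exact (is_derive_continuous _ _ _ (sol_y' _ _ _ _ _ sol r Hr')).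
Qed.

Lemma inverse_y_spec (t : R) : m < t < M ->
  in_itv a b (inverse_y t) /\ y (inverse_y t) = t.
Proof.
  intros Ht. destruct (y_surjective t Ht) as [s [Hs E]]. subst t.
  now rewrite inverse_y_y.
Qed.

Lemma inverse_y_increasing (t u : R) : m < t < M -> m < u < M -> t <= u ->
  inverse_y t <= inverse_y u.
Proof.
  intros Ht Hu Htu. destruct (inverse_y_spec t Ht) as [H1 E1].
  destruct (inverse_y_spec u Hu) as [H2 E2].
  apply Rnot_lt_le. intros C. pose proof (y_increasing _ _ H2 H1 C). lra.
Qed.

Lemma inverse_y_continuous (t : R) : m < t < M -> continuous inverse_y t.
Proof.
  intros Ht. destruct (inverse_y_spec t Ht) as [Hs E].
  set (s := inverse_y t) in *. apply filterlim_locally. intros eps.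
  pose proof (in_itv_locally a b s Hs) as [d Hd].
  set (h := Rmin d eps / 2).
  assert (Hh : 0 < h /\ h < d /\ h < eps).
  { pose proof (cond_pos d). pose proof (cond_pos eps).
    unfold h, Rmin. destruct Rle_dec; lra. }
  assert (H1 : in_itv a b (s - h)).
  { apply Hd. change (Rabs (s - h - s) < d). rewrite Rabs_left; lra. }
  assert (H2 : in_itv a b (s + h)).
  { apply Hd. change (Rabs (s + h - s) < d). rewrite Rabs_pos_eq; lra. }
  pose proof (y_increasing (s - h) s H1 Hs ltac:(lra)) as L1.
  pose proof (y_increasing s (s + h) Hs H2 ltac:(lra)) as L2.
  rewrite E in L1, L2.
  generalize (filter_and _ _ (open_gt _ _ L1) (open_lt _ _ L2)).
  apply filter_imp. intros u [Hu1 Hu2].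
  pose proof (y_range _ H1). pose proof (y_range _ H2).
  destruct (inverse_y_spec u ltac:(lra)) as [Hu Eu].
  rewrite <- Eu in Hu1, Hu2.
  apply y_lt_inv in Hu1; [|easy|easy]. apply y_lt_inv in Hu2; [|easy|easy].
  fold s. change (Rabs (inverse_y u - s) < eps). apply Rabs_lt_between. lra.
Qed.

Lemma graph_derive (t : R) : m < t < M ->
  is_derive (fun t => x (inverse_y t)) t
    (cos (theta (inverse_y t)) / sin (theta (inverse_y t))).
Proof.
  intros Ht. destruct (inverse_y_spec t Ht) as [Hs E].
  unfold Rdiv. rewrite Rmult_comm.
  apply (is_derive_comp x inverse_y); [exact (sol_x' _ _ _ _ _ sol _ Hs)|].
  (* The inverse function rule works on a closed interval around [t]; midpoints keep it inside the
     open range of heights. *)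
  set (lb := (m + t) / 2). set (ub := (t + M) / 2).
  assert (Hlb : m < lb < M) by (unfold lb; lra).
  assert (Hub : m < ub < M) by (unfold ub; lra).
  assert (Hin : lb < t < ub) by (unfold lb, ub; lra).
  destruct (inverse_y_spec lb Hlb) as [Hl _]. destruct (inverse_y_spec ub Hub) as [Hu _].
  apply (is_derive_inverse y inverse_y lb ub); try easy.
  - now apply inverse_y_continuous.
  - intros r Hr. exists (sin (theta r)).
    exact (sol_y' _ _ _ _ _ sol _ (in_itv_between a b _ r _ Hl Hu Hr)).
  - intros r Hr. apply inverse_y_spec. lra.
  - split; apply inverse_y_increasing; lra.
  - exact (sol_y' _ _ _ _ _ sol _ Hs).
  - exact (sol_sin _ _ _ _ _ sol _ Hs).
Qed.

Lemma Derive_graph (t : R) : m < t < M ->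
  Derive (fun t => x (inverse_y t)) t
    = cos (theta (inverse_y t)) / sin (theta (inverse_y t)).
Proof. intros Ht. exact (is_derive_unique _ _ _ (graph_derive t Ht)). Qed.

Lemma graph_over_inverse_y : graph_over a b x y (fun t => x (inverse_y t)) m M.
Proof.
  split.
  - intros s Hs. split; [now apply y_range|]. now rewrite inverse_y_y.
  - exact y_surjective.
Qed.

Lemma Derive_graph_at_left :
  filterlim (fun s => cos (theta s)) (toward a b b) (locally (-1)) ->
  filterlim (Derive (fun t => x (inverse_y t))) (at_left M) (Rbar_locally m_infty).
Proof.
  intros Hc P [K HP].
  pose proof (filterlim_sin_of_cos (toward a b b) theta (-1) ltac:(lra) Hc) as Hsin.
  (* With cos(theta) < - 1 / 2 this bound on sin(theta) gives a slope below - (|K| + 1), hence below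
     [K]. *)
  assert (He : 0 < / (2 * (Rabs K + 1)))
    by (apply Rinv_0_lt_compat; pose proof (Rabs_pos K); lra).
  pose proof (filter_and (F := toward a b b) _ _ (filterlim_lt _ _ _ (- / 2) Hc ltac:(lra))
    (filterlim_lt _ _ _ _ Hsin He)) as Hev.
  apply (toward_right_iff a b s0) in Hev; [|exact s0_in].
  destruct Hev as [s1 [Hs1 Hev]]. pose proof (y_range s1 Hs1) as Hy1.
  assert (Hd : 0 < M - y s1) by lra. exists (mkposreal _ Hd). intros t Hball HtM.
  change (Rabs (t - M) < M - y s1) in Hball. apply Rabs_lt_between in Hball.
  assert (Ht : m < t < M) by lra. destruct (inverse_y_spec t Ht) as [Hs E].
  change (P (Derive (fun t => x (inverse_y t)) t)). rewrite (Derive_graph t Ht).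
  set (s := inverse_y t) in *. destruct (Hev s Hs) as [H1 H2].
  { apply y_lt_inv; [easy|easy|lra]. }
  pose proof (sin_theta_pos s Hs) as Hp. apply HP.
  apply Rlt_div_l; [exact Hp|].
  assert (HK : Rabs K * sin (theta s) < / 2).
  { pose proof (Rabs_pos K).
    apply Rle_lt_trans with ((Rabs K + 1) * sin (theta s)); [nra|].
    apply Rlt_le_trans with ((Rabs K + 1) * / (2 * (Rabs K + 1))).
    - apply Rmult_lt_compat_l; lra.
    - right. field. lra. }
  pose proof (Rle_abs (- K)) as HK'. rewrite Rabs_Ropp in HK'. nra.
Qed.

Lemma Derive_graph_at_right :
  filterlim (fun s => cos (theta s)) (toward a b a) (locally 1) ->
  filterlim (Derive (fun t => x (inverse_y t))) (at_right m) (Rbar_locally p_infty).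
Proof.
  intros Hc P [K HP].
  pose proof (filterlim_sin_of_cos (toward a b a) theta 1 ltac:(lra) Hc) as Hsin.
  assert (He : 0 < / (2 * (Rabs K + 1)))
    by (apply Rinv_0_lt_compat; pose proof (Rabs_pos K); lra).
  pose proof (filter_and (F := toward a b a) _ _ (filterlim_gt _ _ _ (/ 2) Hc ltac:(lra))
    (filterlim_lt _ _ _ _ Hsin He)) as Hev.
  apply (toward_left_iff a b s0) in Hev; [|exact s0_in].
  destruct Hev as [s1 [Hs1 Hev]]. pose proof (y_range s1 Hs1) as Hy1.
  assert (Hd : 0 < y s1 - m) by lra. exists (mkposreal _ Hd). intros t Hball HtM.
  change (Rabs (t - m) < y s1 - m) in Hball. apply Rabs_lt_between in Hball.
  assert (Ht : m < t < M) by lra. destruct (inverse_y_spec t Ht) as [Hs E].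
  change (P (Derive (fun t => x (inverse_y t)) t)). rewrite (Derive_graph t Ht).
  set (s := inverse_y t) in *. destruct (Hev s Hs) as [H1 H2].
  { apply y_lt_inv; [easy|easy|lra]. }
  pose proof (sin_theta_pos s Hs) as Hp. apply HP.
  apply Rlt_div_r; [exact Hp|].
  assert (HK : Rabs K * sin (theta s) < / 2).
  { pose proof (Rabs_pos K).
    apply Rle_lt_trans with ((Rabs K + 1) * sin (theta s)); [nra|].
    apply Rlt_le_trans with ((Rabs K + 1) * / (2 * (Rabs K + 1))).
    - apply Rmult_lt_compat_l; lra.
    - right. field. lra. }
  pose proof (Rle_abs K) as HK'. nra.
Qed.

(** The slope dx/dy is the cotangent of theta. Positive turning makes theta increase with height,
    and the cotangent decreases on (0, PI), which is seen here from sin(theta q - theta p) >= 0. *)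
Lemma graph_concave : (forall s, in_itv a b s -> 0 < turning s) ->
  concave_on (fun t => x (inverse_y t)) m M.
Proof.
  intros Hturn. apply (concave_of_derive_nonincreasing _ _ m M graph_derive).
  intros t u Ht Htu Hu.
  destruct (inverse_y_spec t ltac:(lra)) as [H1 _].
  destruct (inverse_y_spec u ltac:(lra)) as [H2 _].
  pose proof (inverse_y_increasing t u ltac:(lra) ltac:(lra) Htu) as Hle.
  set (p := inverse_y t) in *. set (q := inverse_y u) in *.
  assert (Hth : theta p <= theta q).
  { apply (nondecreasing_of_derive theta (fun s => turning s / (y s * sin (theta s))));
      [exact Hle| |].
    - intros r Hr. apply theta_derive_turning. now apply (in_itv_between a b p r q).
    - intros r Hr. pose proof (in_itv_between a b p r q H1 H2 Hr) as Hin.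
      left. apply Rdiv_lt_0_compat; [now apply Hturn|].
      apply Rmult_lt_0_compat; [now apply y_pos | now apply sin_theta_pos]. }
  pose proof (sin_theta_pos p H1) as Sp. pose proof (sin_theta_pos q H2) as Sq.
  assert (Hdiff : 0 <= sin (theta q - theta p)).
  { pose proof (theta_0_PI p H1). pose proof (theta_0_PI q H2).
    apply sin_ge_0; lra. }
  rewrite sin_minus in Hdiff.
  apply Rle_div_l; [exact Sq|].
  replace (cos (theta p) / sin (theta p) * sin (theta q))
    with (cos (theta p) * sin (theta q) / sin (theta p)) by (field; lra).
  apply Rle_div_r; [exact Sp|]. lra.
Qed.

End Graph.

(** * Vertical points and the tangent direction at the left end *)

Lemma vertical_point (s t : R) : in_itv a b s -> in_itv a b t ->
  cos (theta s) < 0 < cos (theta t) ->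
  exists r, in_itv a b r /\ theta r = PI / 2.
Proof.
  intros Hs Ht H.
  destruct (ivt_in_itv a b (fun r => cos (theta r)) s t 0) as [r [Hr E]]; try easy.
  - intros r Hr. exact (is_derive_continuous _ _ _ (cos_derive_turning r Hr)).
  - exists r. split; [exact Hr|]. pose proof (theta_0_PI r Hr). pose proof PI_RGT_0.
    apply cos_inj; [lra|lra|]. now rewrite cos_PI2.
Qed.

(** Nonpositive turning means y <= sin(theta) cos(theta), so u = cos(theta) is positive, and it is
    nondecreasing. If u stayed above some eps, then u' >= -1 + eps (ln y)', and since ln y tends to
    minus infinity, u would be negative far enough to the left. *)
Lemma cos_theta_left_limit_zero (s1 : R) : in_itv a b s1 -> turning s1 <= 0 ->
  filterlim y (toward a b a) (locally 0) ->
  filterlim (fun s => cos (theta s)) (toward a b a) (locally 0).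
Proof.
  intros Hs1 Hn Hy0.
  assert (Hneg : forall s, in_itv a b s -> s <= s1 -> turning s <= 0)
    by (intros s Hs Hle; now apply (turning_nonpos_before s s1)).
  assert (Hcos : forall s, in_itv a b s -> s <= s1 -> 0 < cos (theta s)).
  { intros s Hs Hle. specialize (Hneg s Hs Hle). unfold turning in Hneg.
    pose proof (y_pos s Hs). pose proof (sin_theta_pos s Hs). nra. }
  assert (Hmono : forall s t, in_itv a b s -> in_itv a b t -> s <= t <= s1 ->
    cos (theta s) <= cos (theta t)).
  { intros s t Hs Ht Hst.
    apply (nondecreasing_of_derive (fun s => cos (theta s))
      (fun s => - (turning s / y s))); [lra| |].
    - intros r Hr. now apply cos_derive_turning, (in_itv_between a b s r t).
    - intros r Hr. pose proof (in_itv_between a b s r t Hs Ht Hr) as Hin.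
      pose proof (Rinv_0_lt_compat _ (y_pos r Hin)).
      specialize (Hneg r Hin ltac:(lra)). unfold Rdiv. nra. }
  apply filterlim_locally. intros eps. pose proof (cond_pos eps) as He.
  destruct (classic
    (exists s2, in_itv a b s2 /\ s2 <= s1 /\ cos (theta s2) < eps)) as [[s2 [H2 [H21 Hc]]]|N].
  { apply (toward_left_iff a b s1); [exact Hs1|]. exists s2. split; [exact H2|].
    intros s Hs Hlt. change (Rabs (cos (theta s) - 0) < eps).
    pose proof (Hcos s Hs ltac:(lra)). pose proof (Hmono s s2 Hs H2 ltac:(lra)).
    rewrite Rminus_0_r, Rabs_pos_eq; lra. }
  exfalso.
  assert (Hge : forall s, in_itv a b s -> s <= s1 -> eps <= cos (theta s)).
  { intros s Hs Hle. apply Rnot_lt_le. intros C. apply N. now exists s. }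
  (* Before [s1] the cosine is positive and smaller, so the sine is at least [k]. Hence y / k has
     derivative at least 1 and absorbs the -1 in u'. *)
  set (k := sin (theta s1)).
  assert (Hk : 0 < k) by now apply sin_theta_pos.
  assert (Hsk : forall s, in_itv a b s -> s <= s1 -> k <= sin (theta s)).
  { intros s Hs Hle. pose proof (sin_theta_pos s Hs).
    pose proof (Hcos s Hs Hle). pose proof (Hmono s s1 Hs Hs1 ltac:(lra)).
    pose proof (sin2_eq (theta s)). pose proof (sin2_eq (theta s1)). unfold k in *. nra. }
  (* cos(theta) >= eps would make this function nondecreasing, although it
     tends to +oo as y -> 0. *)
  set (psi := fun s => cos (theta s) + (y s / k - eps * ln (y s))).
  assert (Hpsi : forall s, in_itv a b s -> s <= s1 -> psi s <= psi s1).
  { intros s Hs Hle.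
    apply (nondecreasing_of_derive psi
      (fun s => (-1 + cos (theta s) * sin (theta s) / y s)
        + sin (theta s) * (/ k - eps * / y s))); [exact Hle| |].
    - intros r Hr. pose proof (in_itv_between a b s r s1 Hs Hs1 Hr) as Hin.
      apply (is_derive_plus (fun s => cos (theta s))
        (fun s => y s / k - eps * ln (y s))).
      + exact (derive_cos_theta _ _ _ _ _ _ sol Hin).
      + apply (is_derive_comp (fun v => v / k - eps * ln v) y);
          [|exact (sol_y' _ _ _ _ _ sol r Hin)].
        pose proof (y_pos r Hin). auto_derive; [easy | field; lra].
    - intros r Hr. pose proof (in_itv_between a b s r s1 Hs Hs1 Hr) as Hin.
      pose proof (Hsk r Hin ltac:(lra)) as K1. pose proof (Hge r Hin ltac:(lra)) as K2.
      pose proof (Rinv_0_lt_compat _ (y_pos r Hin)) as K3.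
      assert (K4 : 1 <= sin (theta r) * / k) by (apply Rle_div_r; lra).
      assert (K5 : 0 <= (cos (theta r) - eps) * (sin (theta r) * / y r)).
      { apply Rmult_le_pos; [lra|]. apply Rmult_le_pos; lra. }
      unfold Rdiv. lra. }
  (* Below this height, - eps ln y alone exceeds |psi s1| + 1, and the other two terms of [psi] are
     positive. *)
  set (q := exp (- ((Rabs (psi s1) + 1) / eps))).
  pose proof (filterlim_lt _ _ _ q Hy0 (exp_pos _)) as Hsmall.
  apply (toward_left_iff a b s1) in Hsmall; [|exact Hs1].
  destruct Hsmall as [s2 [H2 Hsmall]].
  destruct (in_itv_less a b (Rmin s1 s2)) as [s [Hs Hlt]].
  { unfold Rmin. now destruct Rle_dec. }
  pose proof (Rmin_l s1 s2). pose proof (Rmin_r s1 s2).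
  specialize (Hsmall s Hs ltac:(lra)). specialize (Hpsi s Hs ltac:(lra)).
  pose proof (Hcos s Hs ltac:(lra)). pose proof (y_pos s Hs) as Hyp.
  assert (Hln : ln (y s) < - ((Rabs (psi s1) + 1) / eps)).
  { rewrite <- (ln_exp (- _)). now apply ln_increasing. }
  assert (0 < y s / k) by now apply Rdiv_lt_0_compat.
  assert (Hel : eps * ln (y s) < eps * - ((Rabs (psi s1) + 1) / eps))
    by now apply Rmult_lt_compat_l.
  replace (eps * - ((Rabs (psi s1) + 1) / eps)) with (- (Rabs (psi s1) + 1)) in Hel
    by (field; lra).
  pose proof (Rle_abs (psi s1)). unfold psi at 1 in Hpsi. lra.
Qed.

(** Positive turning makes cos(theta) grow toward the left end. If it stayed below 1 - eps, then
    sin(theta) cos(theta) would stay above a positive constant, while positive turning keeps it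
    below y, which tends to 0. *)
Lemma cos_theta_left_limit_one (s0 : R) : in_itv a b s0 ->
  (forall s, in_itv a b s -> 0 < turning s) ->
  filterlim y (toward a b a) (locally 0) ->
  filterlim (fun s => cos (theta s)) (toward a b a) (locally 1).
Proof.
  intros Hs0 Hturn Hy0.
  assert (Hmono : forall s t, in_itv a b s -> in_itv a b t -> s <= t ->
    cos (theta t) <= cos (theta s)).
  { intros s t Hs Ht Hst. apply Ropp_le_cancel.
    apply (nondecreasing_of_derive (fun s => - cos (theta s))
      (fun s => - - (turning s / y s))); [lra| |].
    - intros r Hr. apply (is_derive_opp (fun s => cos (theta s))).
      now apply cos_derive_turning, (in_itv_between a b s r t).
    - intros r Hr. pose proof (in_itv_between a b s r t Hs Ht Hr) as Hin.
      rewrite Ropp_involutive. left. apply Rdiv_lt_0_compat; auto. }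
  assert (Hsmall : forall q, 0 < q -> forall s, in_itv a b s ->
    exists t, in_itv a b t /\ t < s /\ y t < q).
  { intros q Hq s Hs. pose proof (filterlim_lt _ _ _ q Hy0 Hq) as Hev.
    apply (toward_left_iff a b s0) in Hev; [|exact Hs0].
    destruct Hev as [s2 [H2 Hev]].
    destruct (in_itv_less a b (Rmin s s2)) as [t [Ht Hlt]].
    { unfold Rmin. now destruct Rle_dec. }
    pose proof (Rmin_l s s2). pose proof (Rmin_r s s2).
    exists t. split; [exact Ht|]. split; [lra|]. apply Hev; [exact Ht|lra]. }
  (* Where y < exp k the logarithm is below [k], so the monotone quantity, at least [k] before [s0],
     needs a positive term cos(theta) / y. *)
  set (k := cos (theta s0) / y s0 + ln (y s0)).
  destruct (Hsmall (exp k) (exp_pos k) s0 Hs0) as [s3 [H3 [H30 Hy3]]].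
  assert (Hc3 : 0 < cos (theta s3)).
  { pose proof (cos_over_y_plus_ln_y_nonincreasing s3 s0 H3 Hs0 ltac:(lra)) as H.
    fold k in H. pose proof (y_pos s3 H3) as Hyp.
    assert (ln (y s3) < k) by (rewrite <- (ln_exp k); now apply ln_increasing).
    assert (Hq : 0 < cos (theta s3) / y s3) by lra.
    apply Rlt_div_r in Hq; lra. }
  apply filterlim_locally. intros eps. pose proof (cond_pos eps) as He.
  destruct (classic
    (exists s2, in_itv a b s2 /\ 1 - eps < cos (theta s2))) as [[s2 [H2 Hc]]|N].
  { apply (toward_left_iff a b s0); [exact Hs0|]. exists s2. split; [exact H2|].
    intros s Hs Hlt. change (Rabs (cos (theta s) - 1) < eps).
    pose proof (Hmono s s2 Hs H2 ltac:(lra)). pose proof (COS_bound (theta s)).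
    apply Rabs_lt_between. lra. }
  exfalso.
  assert (Hle : forall s, in_itv a b s -> cos (theta s) <= 1 - eps).
  { intros s Hs. apply Rnot_lt_le. intros C. apply N. now exists s. }
  (* As 0 < cos(theta) <= 1 - eps gives sin(theta) >= eps, this height is a lower bound for
     sin(theta) cos(theta) to the left of [s3]. *)
  destruct (Hsmall (eps * cos (theta s3)) ltac:(apply Rmult_lt_0_compat; lra) s3 H3)
    as [s [Hs [Hlt Hys]]].
  pose proof (Hle s Hs). pose proof (Hmono s s3 Hs H3 ltac:(lra)).
  pose proof (sin_theta_pos s Hs). pose proof (SIN_bound (theta s)).
  assert (eps <= sin (theta s)).
  { pose proof (sin2_eq (theta s)). nra. }
  pose proof (Hturn s Hs) as Ht. unfold turning in Ht. nra.
Qed.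

End Upward.

(** * Upper bound on the height and the classification *)

Lemma y_bounded_after (a b : Rbar) (x y theta : R -> R) (s0 : R) :
  soliton_system a b x y theta -> (forall s, in_itv a b s -> 0 < theta s < PI) ->
  in_itv a b s0 -> exists C, forall s, in_itv a b s -> s0 <= s -> y s0 <= y s <= C.
Proof.
  intros Hsol Hr Hs0.
  pose proof (sol_y_pos _ _ _ _ _ Hsol) as Hy.
  (* The last summand pays for dropping cos(theta) / y, which is at least [- / y s0] from [s0]
     on. *)
  exists (exp (cos (theta s0) / y s0 + ln (y s0) + / y s0)).
  intros s Hs Hle.
  assert (Hys : y s0 <= y s).
  { destruct Hle as [Hlt | ->]; [|lra]. left.
    now apply (y_increasing a b x y theta Hsol Hr). }
  split; [exact Hys|].
  pose proof (cos_over_y_plus_ln_y_nonincreasing a b x y theta Hsol s0 s Hs0 Hs Hle).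
  pose proof (Hy s0 Hs0). pose proof (Hy s Hs).
  rewrite <- (exp_ln (y s)) by easy.
  assert (- / y s0 <= cos (theta s) / y s).
  { pose proof (COS_bound (theta s)).
    assert (/ y s <= / y s0) by (apply Rinv_le_contravar; lra).
    assert (0 < / y s) by now apply Rinv_0_lt_compat.
    unfold Rdiv. nra. }
  assert (L : ln (y s) <= cos (theta s0) / y s0 + ln (y s0) + / y s0) by lra.
  destruct L as [L | ->]; [left; now apply exp_increasing | lra].
Qed.

Theorem theorem4p10 (a b : Rbar) (x y theta : R -> R) (y0 theta0 : R)
  (y0_pos : 0 < y0) (theta0_itv : 0 < theta0 < PI)
  (theta0_neq : theta0 <> PI / 2)
  (gamma_max : maximal_solution a b x y theta 0 y0 theta0) :
  (type_I a b x y theta \/ type_II a b x y theta) \/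
  concave_orthogonal_graph a b x y theta.
Proof.
  left. pose proof (max_zero _ _ _ _ _ _ _ _ gamma_max) as H0.
  pose proof (max_sol _ _ _ _ _ _ _ _ gamma_max) as Hsol.
  pose proof (sol_y_pos _ _ _ _ _ Hsol) as y_pos.
  assert (Hr : forall s, in_itv a b s -> 0 < theta s < PI).
  { apply (theta_range a b x y theta 0 Hsol H0).
    now rewrite (max_theta0 _ _ _ _ _ _ _ _ gamma_max). }
  destruct (y_bounded_after a b x y theta 0 Hsol Hr H0) as [C HC].
  destruct (maximal_right_end_cos a b x y theta _ _ _ 0 (y 0) C gamma_max H0 (y_pos 0 H0) HC)
    as [Hcb [M [HM HyM]]].
  destruct (y_left_limit a b x y theta Hsol Hr 0 H0) as [m [Hm [Hym Hmy]]].
  pose proof (y_right_strict_bound a b x y theta Hsol Hr M HyM) as HyltM.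
  assert (Hneg : exists s, in_itv a b s /\ cos (theta s) < 0).
  { pose proof (filterlim_lt _ _ _ 0 Hcb ltac:(lra)) as Hev.
    apply (toward_right_iff a b 0) in Hev; [|exact H0].
    destruct Hev as [s1 [H1 Hev]]. destruct (in_itv_greater _ _ _ H1) as [t [Ht Htl]].
    exists t. auto. }
  destruct Hneg as [sn [Hsn Hcn]].
  (* The cosine is already negative near the right end, so a single point where it is positive
     yields a vertical tangent in between. *)
  assert (Hvert : forall s, in_itv a b s -> 0 < cos (theta s) ->
    vertical_start_up_to_translation a b x y theta).
  { intros s Hs Hc.
    destruct (vertical_point a b x y theta Hsol Hr sn s Hsn Hs (conj Hcn Hc))
      as [r [Hri Hth]].
    exists r, (y r). split; [exact Hri|]. split; [now apply y_pos|].
    rewrite <- Hth. exact (maximal_solution_translate a b x y theta _ _ _ r gamma_max Hri). }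
  assert (Hm1 : 0 < m ->
    filterlim (fun s => cos (theta s)) (toward a b a) (locally 1)).
  { intros Hmp. apply (maximal_left_end_cos a b x y theta _ _ _ 0 m M gamma_max H0 Hmp).
    intros s Hs _. pose proof (Hmy s Hs). pose proof (HyltM s Hs). lra. }
  destruct (classic (exists s, in_itv a b s /\ turning y theta s <= 0))
    as [[s1 [Hs1 Hn]]|N].
  - left.
    assert (Hc1 : 0 < cos (theta s1)).
    { unfold turning in Hn. pose proof (y_pos s1 Hs1).
      pose proof (sin_theta_pos a b theta Hr s1 Hs1). nra. }
    (* To the left of [s1] the cosine is at most its value at [s1], which is below 1; a positive [m]
       would make it tend to 1. *)
    assert (m = 0) as ->.
    { destruct Hm as [Hmp|]; [exfalso|easy]. specialize (Hm1 Hmp).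
      assert (Hlt : cos (theta s1) < 1).
      { pose proof (sin_theta_pos a b theta Hr s1 Hs1).
        pose proof (sin2_eq (theta s1)). nra. }
      pose proof (filterlim_gt _ _ _ _ Hm1 Hlt) as Hev.
      apply (toward_left_iff a b 0) in Hev; [|exact H0].
      destruct Hev as [s2 [H2 Hev]].
      destruct (in_itv_less a b (Rmin s1 s2)) as [t [Ht Htl]].
      { unfold Rmin. now destruct Rle_dec. }
      pose proof (Rmin_l s1 s2). pose proof (Rmin_r s1 s2).
      specialize (Hev t Ht ltac:(lra)).
      assert (cos (theta t) <= cos (theta s1)); [|lra].
      apply (nondecreasing_of_derive (fun s => cos (theta s))
        (fun s => - (turning y theta s / y s))); [lra| |].
      - intros r Hri. apply (cos_derive_turning a b x y theta Hsol).
        now apply (in_itv_between a b t r s1).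
      - intros r Hri. pose proof (in_itv_between a b t r s1 Ht Hs1 Hri) as Hin.
        pose proof (Rinv_0_lt_compat _ (y_pos r Hin)).
        pose proof (turning_nonpos_before a b x y theta Hsol Hr r s1 Hin Hs1
          ltac:(lra) Hn). unfold Rdiv. nra. }
    split; [exact (Hvert s1 Hs1 Hc1)|]. split.
    + exists (fun t => x (inverse_y a b y t)). intros s Hs.
      now rewrite (inverse_y_y a b x y theta Hsol Hr s Hs).
    + exists a, b. split; [now left|]. split.
      * split; [exact Hym|].
        exact (cos_theta_left_limit_zero a b x y theta Hsol Hr s1 Hs1 Hn Hym).
      * exists M. split; [pose proof (y_pos 0 H0); lra|]. split; [exact HyM|].
        exact (filterlim_sin_of_cos (toward a b b) theta (-1) ltac:(lra) Hcb).
  - right.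
    assert (Hturn : forall s, in_itv a b s -> 0 < turning y theta s).
    { intros s Hs. apply Rnot_le_lt. intros Hle. apply N. now exists s. }
    assert (Hca : filterlim (fun s => cos (theta s)) (toward a b a) (locally 1)).
    (* For [m > 0] the limit comes from maximality, for [m = 0] from the positive turning. *)
    { destruct Hm as [Hmp | <-]; [now apply Hm1|].
      exact (cos_theta_left_limit_one a b x y theta Hsol Hr 0 H0 Hturn Hym). }
    assert (Hrange : forall s, in_itv a b s -> m < y s < M) by auto.
    split.
    + pose proof (filterlim_gt _ _ _ 0 Hca ltac:(lra)) as Hev.
      apply (toward_left_iff a b 0) in Hev; [|exact H0].
      destruct Hev as [s2 [H2 Hev]]. destruct (in_itv_less _ _ _ H2) as [t [Ht Htl]].
      apply (Hvert t Ht). now apply Hev.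
    + exists m, M, (fun t => x (inverse_y a b y t)).
      split; [now apply (graph_over_inverse_y a b x y theta Hsol Hr m M 0)|].
      split.
      { intros t Ht. eexists.
        now apply (graph_derive a b x y theta Hsol Hr m M 0). }
      split; [now apply (graph_concave a b x y theta Hsol Hr m M 0)|].
      split.
      * now apply (Derive_graph_at_left a b x y theta Hsol Hr m M 0).
      * now apply (Derive_graph_at_right a b x y theta Hsol Hr m M 0).
Qed.
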